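(* Let $\mathbb{F}$ be a finite field and let $\mathcal{O}$ be an Okubo algebra over $\mathbb{F}$. Then $\mathcal{O}$ is split, that is, $\mathcal{O}$ is isomorphic to the split Okubo algebra $\mathcal{O}_{\mathbb{F}}$ over $\mathbb{F}$.
   Context: Split Okubo algebra. For a field $\mathbb{F}$, the split Okubo algebra $(\mathcal{O}_{\mathbb{F}},*,\mathrm{n})$ is the $8$-dimensional $\mathbb{F}$-algebra with basis $\{z_{i,j} : (i,j)\in(\mathbb{Z}/3)^2,\ (i,j)\neq(0,0)\}$ and multiplication $$z_{i,j}*z_{i',j'}=\begin{cases}0&\text{if }\Delta=2\text{ or }i+i'=0=j+j',\\ -z_{i+i',j+j'}&\text{if }\Delta=1,\\ z_{i+i',j+j'}&\text{otherwise,}\end{cases}\qquad \Delta=ij'-ji'\in\mathbb{Z}/3,$$ endowed with the quadratic form $\mathrm{n}$ determined by $\mathrm{n}(z_{i,j})=0$ for all $(i,j)\ne(0,0)$ and polar form $\mathrm{n}(u,v)=\mathrm{n}(u+v)-\mathrm{n}(u)-\mathrm{n}(v)$ satisfying $\mathrm{n}(z_{i,j},z_{i',j'})=1$ if $i+i'=0=j+j'$ and $0$ otherwise. Okubo algebras. An Okubo algebra over $\mathbb{F}$ is a twisted form of $(\mathcal{O}_{\mathbb{F}},*,\mathrm{n})$, i.e. a triple $(\mathcal{O},*,\mathrm{n})$ with $\mathcal{O}$ an $\mathbb{F}$-vector space, $*$ a bilinear product and $\mathrm{n}$ a quadratic form, that becomes isomorphic to the split Okubo algebra over an algebraic closure $\overline{\mathbb{F}}$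 after extending scalars to $\overline{\mathbb{F}}$. *)

(* Defs.v *)
From HB Require Import structures.
From mathcomp Require Import all_boot all_order all_algebra ring.

Set Implicit Arguments.
Unset Strict Implicit.
Unset Printing Implicit Defensive.

Import GRing.Theory.
Local Open Scope ring_scope.

Section QuadraticAlgebras.
Variable F : fieldType.

Definition polar (V : lmodType F) (n : V -> F) (u v : V) : F :=
  n (u + v) - n u - n v.

Definition quadratic_form (V : lmodType F) (n : V -> F) : Prop :=
  (forall (a : F) (v : V), n (a *: v) = a ^+ 2 * n v) /\
  bilinear_for *%R *%R (polar n).

Record quadAlg := QuadAlg {
  qspace :> lmodType F;
  qmul : {bilinear qspace -> qspace -> qspace};
  qnorm : qspace -> F;
  qnormP : quadratic_form qnorm }.

Arguments qmul : clear implicits.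
Arguments qnorm : clear implicits.

Definition quadAlg_iso (A B : quadAlg) : Prop :=
  exists f : {linear A -> B},
    [/\ bijective f,
        {morph f : x y / qmul A x y >-> qmul B x y} &
        forall x, qnorm B (f x) = qnorm A x].

End QuadraticAlgebras.

Arguments qmul {F}.
Arguments qnorm {F}.

Section ScalarExtension.
Variables (F K : fieldType) (iota : {rmorphism F -> K}).

(* The universal property of W = V (x)_F K, with j v = v (x) 1. *)
Definition is_base_change (V : lmodType F) (W : lmodType K)
    (j : {linear V -> W | iota \; *:%R}) : Prop :=
  forall (U : lmodType K) (g : {linear V -> U | iota \; *:%R}),
    exists h : {linear W -> U},
      h \o j =1 g /\ forall h' : {linear W -> U}, h' \o j =1 g -> h' =1 h.

(* As j(A) spans B over K, the bilinear product and the quadratic form of B are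
   determined by their values on j(A), i.e. by those of A. *)
Definition is_scalar_extension (A : quadAlg F) (B : quadAlg K) : Prop :=
  exists j : {linear A -> B | iota \; *:%R},
    [/\ is_base_change j,
        {morph j : x y / qmul A x y >-> qmul B x y} &
        forall x, qnorm B (j x) = iota (qnorm A x)].

End ScalarExtension.

Definition oindex := {p : 'Z_3 * 'Z_3 | p != 0}.

Section SplitOkubo.
Variable F : fieldType.

(* F^o is F as a module over itself: O is the space of families (x_p). *)
Local Notation O := {ffun oindex -> F^o}.

(* The basis vector z_p for p != 0; also z_0 = 0. *)
Definition oz (p : 'Z_3 * 'Z_3) : O := [ffun k => (val k == p)%:R].

Definition odelta (p q : 'Z_3 * 'Z_3) : 'Z_3 := p.1 * q.2 - p.2 * q.1.

Definition oz_mul (p q : 'Z_3 * 'Z_3) : O :=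
  if (odelta p q == 2%:R) || (p + q == 0) then 0
  else if odelta p q == 1 then - oz (p + q)
  else oz (p + q).

Definition okubo_mul (x y : O) : O :=
  \sum_(p : oindex) \sum_(q : oindex) (x p * y q) *: oz_mul (val p) (val q).

(* One term x_p x_(-p) for each of the four pairs {p, -p}, each pair being
   listed once by means of the enumeration of the index set. *)
Definition okubo_norm (x : O) : F :=
  \sum_(p : oindex) \sum_(q : oindex | (enum_rank p < enum_rank q)%N)
     (x p * x q) *+ (val p + val q == 0).

Definition opolar (x y : O) : F :=
  \sum_(p : oindex) \sum_(q : oindex) (x p * y q) *+ (val p + val q == 0).

Lemma okubo_mul_bilinear : bilinear_for *:%R *:%R okubo_mul.
Proof.
split=> [y | x] a u v /=; rewrite scaler_sumr -big_split; apply: eq_bigr=> p _;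
  rewrite scaler_sumr -big_split; apply: eq_bigr=> q _;
  rewrite /= !ffunE scalerA -scalerDl; congr (_ *: _).
- by rewrite mulrDl mulrA.
- by rewrite mulrDr mulrCA.
Qed.

HB.instance Definition _ :=
  bilinear_isBilinear.Build F O O O *:%R *:%R okubo_mul okubo_mul_bilinear.

Lemma oindexN_neq (p q : oindex) : val p + val q == 0 -> p != q.
Proof.
move=> E; apply: contraTneq (valP p) => pq; move: E; rewrite -{}pq negbK.
by case: (val p) => -[[|[|[|//]]] ?] [[|[|[|//]]] ?].
Qed.

Lemma okubo_polarE : polar okubo_norm =2 opolar.
Proof.
move=> x y; rewrite /polar /okubo_norm /opolar -!sumrB.
pose G (p q : oindex) : F := (x p * y q) *+ (val p + val q == 0).
have GS : \sum_p \sum_q G p q =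
    \sum_p \sum_(q | (enum_rank p < enum_rank q)%N) (G p q + G q p).
  under [RHS]eq_bigr do rewrite big_split /=.
  rewrite big_split /= [X in _ + X](exchange_big_dep xpredT) //= -big_split /=.
  apply: eq_bigr => p _.
  rewrite (bigID (fun q => (enum_rank p < enum_rank q)%N)) /=; congr (_ + _).
  rewrite (bigID (fun q => enum_rank q == enum_rank p)) /= big1 ?add0r.
    by apply: eq_bigl => q; rewrite -leqNgt ltn_neqAle andbC.
  move=> q /andP[_ /eqP/enum_rank_inj ->]; rewrite /G.
  by case: eqP => // /eqP/oindexN_neq; rewrite eqxx.
rewrite -/(\sum_p \sum_q G p q) GS; apply: eq_bigr => p _.
rewrite -!sumrB; apply: eq_bigr => q _; rewrite /G !ffunE [val q + _]addrC.
rewrite -!mulrnBl -mulrnDl; congr (_ *+ _).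
by rewrite mulrDl !mulrDr [x q * _]mulrC; ring.
Qed.

Lemma opolar_bilinear : bilinear_for *%R *%R opolar.
Proof.
split=> [y | x] a u v /=; rewrite mulr_sumr -big_split; apply: eq_bigr=> p _;
  rewrite mulr_sumr -big_split; apply: eq_bigr=> q _;
  rewrite !ffunE -[RHS]/(_ + _) mulrnAr -mulrnDl; congr (_ *+ _).
- by rewrite mulrDl mulrA.
- by rewrite mulrDr mulrCA.
Qed.

Lemma okubo_norm_quadratic : quadratic_form okubo_norm.
Proof.
split=> [a x | ].
  rewrite /okubo_norm mulr_sumr; apply: eq_bigr => p _; rewrite mulr_sumr.
  apply: eq_bigr => q _; rewrite mulrnAr !ffunE; congr (_ *+ _).
  by rewrite mulrACA.
have [H1 H2] := opolar_bilinear.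
by split=> [y | x] a u v /=; rewrite !okubo_polarE ?H1 ?H2.
Qed.

Lemma okubo_mul_oz (p q : oindex) :
  okubo_mul (oz (val p)) (oz (val q)) = oz_mul (val p) (val q).
Proof.
rewrite /okubo_mul (bigD1 p) //= (bigD1 q) //= !ffunE !eqxx mulr1 scale1r.
rewrite !big1 ?addr0 // => [p' /negPf np | q' /negPf nq].
  by rewrite big1 // => q' _; rewrite !ffunE val_eqE np mul0r scale0r.
by rewrite !ffunE !val_eqE nq mulr0 scale0r.
Qed.

Lemma opolar_oz (p q : oindex) :
  polar okubo_norm (oz (val p)) (oz (val q)) = (val p + val q == 0)%:R.
Proof.
rewrite okubo_polarE /opolar (bigD1 p) //= (bigD1 q) //= !ffunE !eqxx mulr1.
rewrite !big1 ?addr0 // => [p' /negPf np | q' /negPf nq].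
  by rewrite big1 // => q' _; rewrite !ffunE val_eqE np mul0r mul0rn.
by rewrite !ffunE !val_eqE nq mulr0 mul0rn.
Qed.

Lemma okubo_norm_oz (p : oindex) : okubo_norm (oz (val p)) = 0.
Proof.
rewrite /okubo_norm big1 // => q _; rewrite big1 // => r ltqr.
rewrite !ffunE !val_eqE; case: (q =P p) => [qp|_]; last by rewrite mul0r mul0rn.
case: (r =P p) => [rp|_]; last by rewrite mulr0 mul0rn.
by rewrite qp rp ltnn in ltqr.
Qed.

Definition split_okubo : quadAlg F :=
  QuadAlg okubo_mul okubo_norm_quadratic.

End SplitOkubo.

Definition is_algebraic_closure (F : fieldType) (K : closedFieldType)
    (iota : {rmorphism F -> K}) : Prop := integralRange iota.

(* All algebraic closures of F are isomorphic over F, so that the choice of K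
   is immaterial. *)
Definition is_okubo (F : fieldType) (A : quadAlg F) : Prop :=
  exists (K : closedFieldType) (iota : {rmorphism F -> K}) (B : quadAlg K),
    [/\ is_algebraic_closure iota, is_scalar_extension iota A B &
        quadAlg_iso B (split_okubo K)].

(* Main.v *)
Require Import Defs.
From HB Require Import structures.
From mathcomp Require Import all_boot all_order all_algebra all_fingroup.
From mathcomp Require Import all_solvable all_field ring.
From mathcomp Require Import boolp classical_sets.

Set Implicit Arguments.
Unset Strict Implicit.
Unset Printing Implicit Defensive.

Import GRing.Theory.
Local Open Scope ring_scope.

(* An Okubo algebra is a symmetric composition algebra: (a b) a = n(a) b =
   a (b a) and n(a b, c) = n(a, b c); moreover no nonzero element commutes with
   every other one.  Let g(a) = n(a, a a).  By Chevalley-Warning there is u != 0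
   with n(u) = g(u) = 0; then v = u or v = u u satisfies n(v) = 0 and v v = 0,
   so that g(v a) = - n(v, a)^3 and some x = v a has n(x) = 0 and g(x) = 1.  On
   V = {b | b x = 0, n(b, x) = 0} left multiplication by x has cube -1, and
   g(k b - l (x b) + m (x (x b))) = g(b) (k^3 + l^3 + m^3 - 3 k l m).  Hence, if
   g does not vanish on V, it takes the value 1 there at some y, and x, y
   generate a split Okubo algebra.
   If g vanishes on V, one finds a nonzero central element: in characteristic
   different from 3 this follows from polarizing g, while in characteristic 3,
   where g is additive, it is x + x x provided g vanishes on V for every choice
   of x.  The dimension of the algebra over F and the injectivity of
   O -> O (x) K come from the universal property of the base change, tested on
   linear forms whose existence is due to Zorn's lemma. *)

(** * Symmetric composition algebras *)

Section Polar.
Variables (F : fieldType) (A : quadAlg F).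
Implicit Types (a : F) (u v w : A).

Definition qpolar u v := polar (qnorm A) u v.

Lemma qnormZ a v : qnorm A (a *: v) = a ^+ 2 * qnorm A v.
Proof. exact: (proj1 (qnormP A)). Qed.

Lemma qpolar_bilinear : bilinear_for *%R *%R qpolar.
Proof. exact: (proj2 (qnormP A)). Qed.

HB.instance Definition _ :=
  bilinear_isBilinear.Build F A A F *%R *%R qpolar qpolar_bilinear.

Lemma qpolarC u v : qpolar u v = qpolar v u.
Proof. by rewrite /qpolar /polar [u + v]addrC addrAC. Qed.

Lemma qpolarDl u v w : qpolar (u + v) w = qpolar u w + qpolar v w.
Proof. exact: linearDl. Qed.
Lemma qpolarDr u v w : qpolar u (v + w) = qpolar u v + qpolar u w.
Proof. exact: linearDr. Qed.
Lemma qpolarNl u v : qpolar (- u) v = - qpolar u v.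
Proof. exact: linearNl. Qed.
Lemma qpolarNr u v : qpolar u (- v) = - qpolar u v.
Proof. exact: linearNr. Qed.
Lemma qpolarZl a u v : qpolar (a *: u) v = a * qpolar u v.
Proof. exact: linearZl_LR. Qed.
Lemma qpolarZr a u v : qpolar u (a *: v) = a * qpolar u v.
Proof. exact: linearZr_LR. Qed.
Lemma qpolar0l u : qpolar 0 u = 0.
Proof. exact: linear0l. Qed.
Lemma qpolar0r u : qpolar u 0 = 0.
Proof. exact: linear0r. Qed.

Lemma qnorm0 : qnorm A 0 = 0.
Proof. by rewrite -[0 in LHS](scale0r 0) qnormZ expr2 !mul0r. Qed.

Lemma qnormD u v : qnorm A (u + v) = qnorm A u + qnorm A v + qpolar u v.
Proof. by rewrite /qpolar /polar; ring. Qed.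

Lemma qpolarxx u : qpolar u u = 2%:R * qnorm A u.
Proof. by rewrite /qpolar /polar -mulr2n -scaler_nat qnormZ; ring. Qed.

End Polar.

Definition polarE :=
  (qpolarDl, qpolarDr, qpolarNl, qpolarNr, qpolarZl, qpolarZr, qpolar0l,
   qpolar0r).

Local Notation "x ** y" := (qmul _ x y)
  (at level 40, left associativity) : ring_scope.
Local Notation "''[' x , y ]" := (qpolar x y) : ring_scope.

Section SymmetricComposition.
Variables (F : fieldType) (A : quadAlg F).

Local Notation n := (qnorm A).

Definition symmetric_composition :=
  [/\ forall a b : A, (a ** b) ** a = n a *: b,
      forall a b : A, a ** (b ** a) = n a *: b &
      forall a b c : A, '[a ** b, c] = '[a, b ** c]].

Definition polar_nondegenerate := forall a : A, (forall b, '[a, b] = 0) -> a =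
  0.

Definition centerless := forall a : A, (forall b, a ** b = b ** a) -> a = 0.

Definition cubic (a : A) : F := '[a, a ** a].

End SymmetricComposition.

(** * The opposite algebra *)

Section Opposite.
Variables (F : fieldType) (A : quadAlg F).

Definition opmul (x y : A) := qmul A y x.

Lemma opmul_bilinear : bilinear_for *:%R *:%R opmul.
Proof.
by split=> [y|x] a u v; rewrite /opmul /= ?linearPr ?linearPl.
Qed.

HB.instance Definition _ :=
  bilinear_isBilinear.Build F A A A *:%R *:%R opmul opmul_bilinear.

(** The space and the norm are those of [A], so each fact about left multiplication by [x] yields by
    conversion its mirror image for right multiplication. *)
Definition opAlg : quadAlg F := @QuadAlg F A opmul _ (qnormP A).

Lemma opAlg_symmetric : symmetric_composition A -> symmetric_composition opAlg.
Proof.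
case=> HA HB HC; split=> a b; [exact: HB | exact: HA | move=> c].
have := HC c b a; rewrite qpolarC [RHS]qpolarC => E.
exact: esym E.
Qed.

End Opposite.

Section Products.
Variables (F : fieldType) (A : quadAlg F).
Implicit Types a b c d w x y : A.

Local Notation n := (qnorm A).
Local Notation g := (@cubic F A).

Lemma smulDl a b c : (a + b) ** c = a ** c + b ** c.
Proof. exact: linearDl. Qed.
Lemma smulDr a b c : a ** (b + c) = a ** b + a ** c.
Proof. exact: linearDr. Qed.
Lemma smulNl a b : (- a) ** b = - (a ** b).
Proof. exact: linearNl. Qed.
Lemma smulNr a b : a ** (- b) = - (a ** b).
Proof. exact: linearNr. Qed.
Lemma smulZl k a b : (k *: a) ** b = k *: (a ** b).
Proof. exact: linearZl_LR. Qed.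
Lemma smulZr k a b : a ** (k *: b) = k *: (a ** b).
Proof. exact: linearZr_LR. Qed.
Lemma smul0l a : 0 ** a = 0.
Proof. exact: linear0l. Qed.
Lemma smul0r a : a ** 0 = 0.
Proof. exact: linear0r. Qed.

End Products.

Definition smulE := (smulDl, smulDr, smulNl, smulNr, smulZl, smulZr, smul0l,
   smul0r).

Section Identities.
Variables (F : fieldType) (A : quadAlg F).
Hypothesis symA : symmetric_composition A.
Implicit Types a b c d w x y : A.

Local Notation n := (qnorm A).
Local Notation g := (@cubic F A).

Lemma smulK a b : (a ** b) ** a = n a *: b.
Proof. by case: symA. Qed.
Lemma smulVK a b : a ** (b ** a) = n a *: b.
Proof. by case: symA. Qed.
Lemma polarA a b c : '[a ** b, c] = '[a, b ** c].
Proof. by case: symA. Qed.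

(** Polarization of [smulK] in its outer argument, at [a + c]. *)
Lemma smulACl a b c : (a ** b) ** c = '[a, c] *: b - (c ** b) ** a.
Proof.
have := smulK (a + c) b; rewrite qnormD !smulE !smulK 2!(scalerDl b _ _)
  -!addrA.
by move=> /addrI; rewrite addrA [RHS]addrC => /addIr <-; rewrite ?addrK //
  addrC addrK.
Qed.

Lemma smulACr a b c : a ** (b ** c) = '[a, c] *: b - c ** (b ** a).
Proof.
have := smulVK (a + c) b; rewrite qnormD !smulE !smulVK 2!(scalerDl b _ _)
  -!addrA.
by move=> /addrI; rewrite addrA [RHS]addrC => /addIr <-; rewrite ?addrK //
  addrC addrK.
Qed.

Lemma polarAdj a b c : '[a ** b, c] = '[b, c ** a].
Proof. by rewrite qpolarC -polarA qpolarC. Qed.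

(** Two evaluations of ((a b) a) (a b): as n(a b) a, and as n(a) b (a b) = n(a) n(b) a. For a != 0
    the scalars can be compared. *)
Lemma qnormM a b : n (a ** b) = n a * n b.
Proof.
have [->|a0] := eqVneq a 0; first by rewrite smul0l qnorm0 mul0r.
have := smulK (a ** b) a; rewrite (smulK a b) smulZl smulVK scalerA => /eqP.
rewrite -subr_eq0 -scalerBl scaler_eq0 (negPf a0) orbF subr_eq0 eq_sym.
by move=> /eqP.
Qed.

Lemma cubicZ k a : g (k *: a) = k ^+ 3 * g a.
Proof. by rewrite /cubic !smulE !polarE; ring. Qed.

Lemma smul_sqr a : (a ** a) ** (a ** a) = g a *: a - n a *: (a ** a).
Proof. by rewrite smulACl smulK smulE. Qed.

(** As u u = 0, the square of u a is n(a a, u) u - n(u, a) a u. Pairing with u a kills the first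
    term, and n(u a, a u) = n(u, a)^2. *)
Lemma cubic_mul_sqr0 u a : n u = 0 -> u ** u = 0 ->
  g (u ** a) = - '[u, a] ^+ 3.
Proof.
move=> nu uu.
have E : (u ** a) ** (u ** a) = '[a ** a, u] *: u - '[u, a] *: (a ** u).
  rewrite smulACl -(polarA u u a) uu qpolar0l scale0r sub0r (smulACl u a a)
    !smulE.
  rewrite (smulACl (a ** a)) uu smul0l subr0 opprB; congr (_ - _ *: _).
have E1 : '[u ** a, u] = 0 by rewrite polarAdj uu qpolar0r.
have E2 : '[u ** a, a ** u] = '[u, a] ^+ 2.
  rewrite polarA smulACr !polarE -(polarA u u) uu qpolar0l; rewrite (qpolarC a
    u).
  by ring.
by rewrite /cubic E !polarE E1 E2; ring.
Qed.

(** For normalized [x] this is one of two totally isotropic pieces into which the orthogonal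
    complement of x and x x splits; [oppeirce] below is the other. *)
Definition peirce x b := b ** x = 0 /\ '[b, x] = 0.

Lemma peirceD x b c : peirce x b -> peirce x c -> peirce x (b + c).
Proof. by move=> [h1 h2] [h3 h4]; split; rewrite ?smulE ?polarE ?h1 ?h2 ?h3 ?h4
  addr0. Qed.

Lemma peirceZ x k b : peirce x b -> peirce x (k *: b).
Proof. by move=> [h1 h2]; split; rewrite ?smulE ?polarE ?h1 ?h2 ?scaler0
  ?mulr0. Qed.

Definition normalized x := n x = 0 /\ g x = 1.

Section Peirce.
Variable x : A.
Hypothesis hx : normalized x.
Let X := x ** x.

Let nx : n x = 0. Proof. by case: hx. Qed.

Lemma norm_xX : '[x, X] = 1. Proof. by case: hx. Qed.
Lemma norm_xx : '[x, x] = 0. Proof. by rewrite qpolarxx nx mulr0. Qed.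
Lemma norm_X : n X = 0. Proof. by rewrite qnormM nx mulr0. Qed.
Lemma norm_XX : '[X, X] = 0. Proof. by rewrite qpolarxx norm_X mulr0. Qed.
Lemma mul_xX : x ** X = 0. Proof. by rewrite smulVK nx scale0r. Qed.
Lemma mul_Xx : X ** x = 0. Proof. by rewrite smulK nx scale0r. Qed.
Lemma mul_XX : X ** X = x.
Proof. by rewrite smul_sqr nx scale0r subr0 [g x]norm_xX scale1r. Qed.

Lemma normalized_sqr : normalized X.
Proof. by split; [exact: norm_X | rewrite /cubic mul_XX qpolarC norm_xX]. Qed.

Let x_neq0 : x != 0.
Proof. by apply: contra_eq_neq norm_xX => ->; rewrite qpolar0l eq_sym
  oner_neq0. Qed.

Lemma peirce_norm b : peirce x b -> n b = 0.
Proof.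
case=> bx _; have := smulK b x; rewrite bx smul0l => /esym/eqP.
by rewrite scaler_eq0 (negPf x_neq0) orbF => /eqP.
Qed.

Lemma peirce_polar b c : peirce x b -> peirce x c -> '[b, c] = 0.
Proof.
move=> hb hc; have := qnormD b c.
by rewrite !peirce_norm ?add0r //; exact: peirceD.
Qed.

Lemma peirce_polarX b : peirce x b -> '[b, X] = 0.
Proof. by case=> bx _; rewrite -polarA bx qpolar0l. Qed.

Lemma peirce_mulX b : peirce x b -> b ** X = - (x ** (x ** b)).
Proof. by case=> _ bx; rewrite (smulACr b x x) bx scale0r sub0r. Qed.

Lemma peirce_Xmul b : peirce x b -> X ** b = 0.
Proof.
by case=> bx nbx; rewrite (smulACl x x b) bx smul0l subr0 qpolarC nbx scale0r.
Qed.

Lemma peirce_lmul b : '[b, X] = 0 -> peirce x (x ** b).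
Proof. by move=> bX; split; [rewrite smulK nx scale0r | rewrite polarAdj]. Qed.

Lemma peirce_xmul b : peirce x b -> peirce x (x ** b).
Proof. by move=> hb; apply/peirce_lmul/peirce_polarX. Qed.

(** By [peirce_mulX], x (x b) = - b X, and polarizing a (b a) at x and X gives x (b X) = n(x, X) b -
    X (b x) = b. *)
Lemma peirce_x3 b : peirce x b -> x ** (x ** (x ** b)) = - b.
Proof.
move=> hb; rewrite -[x ** (x ** b)]opprK -peirce_mulX // smulE smulACr.
by case: hb => -> _; rewrite norm_xX scale1r smul0r subr0.
Qed.

(* That is, -(x ** (x ** (x ** w))) is the projection of w on peirce x. *)
Lemma peirce_lmul3 w : peirce x (x ** (x ** (x ** w))).
Proof.
by apply: peirce_lmul; rewrite polarAdj mul_Xx qpolar0r.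
Qed.

Lemma peirce_mul_x b c : peirce x c -> (x ** b) ** c = - ((c ** b) ** x).
Proof. by case=> _ cx; rewrite smulACl qpolarC cx scale0r sub0r. Qed.

Lemma peirce_x_mul b c : peirce x b -> peirce x c ->
  b ** (x ** c) = - (c ** (x ** b)).
Proof. by move=> hb hc; rewrite smulACr peirce_polar // scale0r sub0r. Qed.

(** Writing c = x (c X) makes [smulACr] applicable to d (x (c X)), whose second term contains x d =
    0. *)
Lemma peirce_mul_op d c : x ** d = 0 -> peirce x c ->
  d ** c = '[d, c ** X] *: x.
Proof.
move=> xd hc.
have {1}-> : c = x ** (c ** X).
  by rewrite peirce_mulX // smulE peirce_x3 // opprK.
by rewrite smulACr xd smul0r subr0.
Qed.

End Peirce.

End Identities.

(** * The decomposition defined by a normalized element *)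

Section PeirceDecomposition.
Variables (F : fieldType) (A : quadAlg F).
Hypothesis symA : symmetric_composition A.
Implicit Types a b c d w : A.

Local Notation n := (qnorm A).
Local Notation g := (@cubic F A).
Local Notation symO := (opAlg_symmetric symA).

(** This is [peirce x] of the opposite algebra, unfolded; hence the one-line proofs below. *)
Definition oppeirce (x d : A) := x ** d = 0 /\ '[d, x] = 0.

Variable x : A.
Hypothesis hx : normalized x.
Let X := x ** x.

Let hxO : @normalized F (opAlg A) x. Proof. by []. Qed.

Lemma oppeirce_Xmul d : oppeirce x d -> X ** d = - ((d ** x) ** x).
Proof. exact: (peirce_mulX symO (x := x)). Qed.

Lemma oppeirce_mulX d : oppeirce x d -> d ** X = 0.
Proof. exact: (peirce_Xmul symO (x := x)). Qed.

Lemma oppeirce_polarX d : oppeirce x d -> '[d, X] = 0.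
Proof. exact: (peirce_polarX symO (x := x)). Qed.

Lemma oppeirce_mulx d : oppeirce x d -> oppeirce x (d ** x).
Proof. exact: (peirce_xmul symO hxO). Qed.

Lemma oppeirce_x3 d : oppeirce x d -> ((d ** x) ** x) ** x = - d.
Proof. exact: (peirce_x3 symO hxO). Qed.

Lemma oppeirce_mulx3 w : oppeirce x (((w ** x) ** x) ** x).
Proof. exact: (peirce_lmul3 symO hxO). Qed.

Lemma oppeirce_polar d c : oppeirce x d -> oppeirce x c -> '[d, c] = 0.
Proof. exact: (peirce_polar symO hxO). Qed.

Lemma oppeirceD d c : oppeirce x d -> oppeirce x c -> oppeirce x (d + c).
Proof. exact: (@peirceD F (opAlg A)). Qed.

Lemma oppeirceZ k d : oppeirce x d -> oppeirce x (k *: d).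
Proof. exact: (@peirceZ F (opAlg A)). Qed.

Lemma oppeirce_mul d c : oppeirce x d -> peirce x c -> d ** c = '[d, c ** X] *:
  x.
Proof. by case=> xd _; apply: peirce_mul_op. Qed.

Lemma peirce_mul_oppeirce b d : peirce x b -> oppeirce x d ->
  b ** d = - '[X ** d, b ** X] *: X.
Proof.
move=> hb hd; have hXd : oppeirce x (X ** d).
  rewrite oppeirce_Xmul // -scaleN1r; apply: oppeirceZ.
  by do 2!apply: oppeirce_mulx.
have {1}-> : d = (X ** d) ** x.
  by rewrite oppeirce_Xmul // smulE oppeirce_x3 // opprK.
rewrite (smulACr symA); case: (hb) => _ ->; rewrite scale0r sub0r (oppeirce_mul
  hXd hb).
by rewrite smulE scaleNr.
Qed.

Lemma peirce_mul b c : peirce x b -> peirce x c -> oppeirce x (b ** c).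
Proof.
move=> [bx _] [cx nc]; split; last by rewrite (polarA symA) cx qpolar0r.
by rewrite (smulACr symA) bx smul0r subr0 qpolarC nc scale0r.
Qed.

(** Expanding x (x (x w)) gives n(w, x) X - w + X (w x), and X (w x) = n(w, X) x - ((w x) x) x;
    eliminating X (w x) yields the formula. *)
Lemma peirce_decomposition w :
  w = '[w, X] *: x + '[w, x] *: X - x ** (x ** (x ** w)) - ((w ** x) ** x) ** x.
Proof.
rewrite (smulACr symA x x w) -/X !smulE -/X (smulACr symA x w X) norm_xX //
  scale1r.
rewrite (smulACl symA x x (w ** x)) (qpolarC x (w ** x)) (polarA symA) -/X.
rewrite (qpolarC x w); set p := '[w, X] *: x; set q := _ *: X.
by rewrite !opprB addrA (addrAC (p + q)) addrK addrCA subrKC addrK.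
Qed.

End PeirceDecomposition.

(** * Nonvanishing of the cubic form *)

Section CubicNonzero.
Variables (F : fieldType) (A : quadAlg F).
Hypothesis symA : symmetric_composition A.
Hypothesis ndA : polar_nondegenerate A.
Hypothesis centA : centerless A.
Implicit Types a b c d w : A.

Local Notation n := (qnorm A).
Local Notation g := (@cubic F A).

Section Fixed.
Variable x : A.
Hypothesis hx : normalized x.
Let X := x ** x.

(** An element of [oppeirce x] is orthogonal to x, to x x and to all of [oppeirce x], so by the
    decomposition only its pairing with [peirce x] can be nonzero. *)
Lemma oppeirce_eq0 d : oppeirce x d ->
  (forall c, peirce x c -> '[d, c] = 0) -> d = 0.
Proof.
move=> hd H; apply: ndA => w; rewrite (peirce_decomposition symA hx w) !polarE.
rewrite (oppeirce_polarX symA hd) (oppeirce_polar symA hx hd (oppeirce_mulx3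
  symA hx w)).
by rewrite (H _ (peirce_lmul3 symA hx w)); case: hd => _ ->; ring.
Qed.

Lemma peirce_eq0 c : peirce x c ->
  (forall d, oppeirce x d -> '[d, c] = 0) -> c = 0.
Proof.
move=> hc H; apply: ndA => w; rewrite (peirce_decomposition symA hx w) !polarE.
rewrite (peirce_polarX symA hc) (peirce_polar symA hx hc (peirce_lmul3 symA hx
  w)).
rewrite (qpolarC c (_ ** x)) (H _ (oppeirce_mulx3 symA hx w)).
by case: hc => _ ->; ring.
Qed.

(** * Contradiction from an anticommutative product on [peirce x] *)

Section Skew.
Hypothesis skew : forall a b c, peirce x a -> peirce x b -> peirce x c ->
  '[a, b ** c + c ** b] = 0.

Lemma skew_mul b c : peirce x b -> peirce x c -> b ** c = - (c ** b).
Proof.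
move=> hb hc; apply/eqP; rewrite -subr_eq0 opprK; apply/eqP/oppeirce_eq0.
  by apply: oppeirceD; exact: peirce_mul.
by move=> a ha; rewrite qpolarC; exact: skew.
Qed.

(** The elements c and x c commute, so (c (x c)) d = ((x c) c) d. After expansion by [smulACl] the
    multiples of x c cancel and this relation remains. *)
Lemma skew_polar c d : peirce x c -> oppeirce x d ->
  '[d, x ** (x ** c)] *: (x ** (x ** c)) = - '[d, x ** c] *: c.
Proof.
move=> hc hd; have hxc := peirce_xmul symA hx hc.
have E : (c ** (x ** c)) ** d = ((x ** c) ** c) ** d.
  by rewrite (peirce_x_mul symA hx hc hc) (skew_mul hc hxc) opprK.
move: E; rewrite !(smulACl symA _ _ d) !(oppeirce_mul symA hx hd) //.
rewrite !(peirce_mulX symA) // -/X (peirce_x3 symA hx) // opprK !smulE !polarE.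
rewrite (qpolarC c) subrr => /esym/eqP; rewrite subr_eq0 qpolarC => /eqP E.
by rewrite scaleNr E scaleNr opprK.
Qed.

(** Choosing d with n(d, x (x c)) != 0 in [skew_polar] makes x (x c) a multiple of c; since x (x (x
    c)) = - c, so is x c. *)
Lemma skew_eigen c : peirce x c -> exists mu, x ** c = mu *: c.
Proof.
move=> hc; have hxc := peirce_xmul symA hx hc; have hxxc := peirce_xmul symA hx
  hxc.
have [c0|c0] := eqVneq c 0; first by exists 0; rewrite c0 smul0r scaler0.
have [d [hd nd]] : exists d, oppeirce x d /\ '[d, x ** (x ** c)] != 0.
  apply: contrapT => H; case/eqP: c0; apply/eqP.
  have : x ** (x ** c) = 0.
    apply: peirce_eq0 => // d hd; apply/eqP/negPn/negP => nd; apply: H.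
    by exists d.
  move/(congr1 (qmul A x)); rewrite (peirce_x3 symA hx hc) smul0r => /eqP.
  by rewrite oppr_eq0.
have [nu E] : exists nu, x ** (x ** c) = nu *: c.
  exists ('[d, x ** (x ** c)]^-1 * - '[d, x ** c]).
  by rewrite -scalerA -skew_polar // scalerA mulVf // scale1r.
have := peirce_x3 symA hx hc; rewrite E smulE => E2; exists (- nu^-1).
have nu0 : nu != 0.
  by apply: contraNneq c0 => nu0; move: E2; rewrite nu0 scale0r -oppr_eq0 => <-.
by rewrite scaleNr -scalerN -E2 scalerA mulVf // scale1r.
Qed.

Lemma skew_scalar : exists mu, forall c, peirce x c -> x ** c = mu *: c.
Proof.
have [[c0 [h0 n0]]|H] := pselect (exists c, peirce x c /\ c != 0); last first.
  exists 0 => c hc; have [->|c0] := eqVneq c 0; first by rewrite smul0r scaler0.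
  by case: H; exists c.
have [mu E0] := skew_eigen h0; exists mu => c hc.
have [nu E] := skew_eigen hc; have [ka] := skew_eigen (peirceD h0 hc).
rewrite smulE E0 E scalerDr => /eqP.
rewrite -subr_eq0 opprD addrACA -!scalerBl addr_eq0 => /eqP E1.
have [e|ne] := eqVneq mu ka.
  move: E1; rewrite -e subrr scale0r => /eqP.
  rewrite eq_sym oppr_eq0 scaler_eq0 subr_eq0 => /orP[/eqP->//|/eqP->].
  by rewrite !scaler0.
(* If the eigenvalues at c0 and at c0 + c differ, c0 is a multiple of c, and both then have the same
   eigenvalue. *)
have [k c0E] : exists k, c0 = k *: c.
  exists ((mu - ka)^-1 * - (nu - ka)).
  rewrite -scalerA scaleNr -E1 scalerA mulVf ?scale1r //.
  by rewrite subr_eq0.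
move: n0 E0; rewrite c0E => n0.
have k0 : k != 0 by apply: contraNneq n0 => ->; rewrite scale0r.
rewrite smulZr scalerA [mu * k]mulrC -scalerA -E; exact: scalerI.
Qed.

(** If x acts on [peirce x] as the scalar mu, then x x - mu x commutes with every component of the
    decomposition, hence vanishes; but it pairs to 1 with x. *)
Lemma skew_false : False.
Proof.
have [mu hmu] := skew_scalar.
(* Right multiplication by x on [oppeirce x] is adjoint to left multiplication by x on [peirce x],
   so it is the same scalar. *)
have hmu' d : oppeirce x d -> d ** x = mu *: d.
  move=> hd; apply/eqP; rewrite -subr_eq0 -scaleNr; apply/eqP/oppeirce_eq0.
    by apply: oppeirceD; [exact: oppeirce_mulx | exact: oppeirceZ].
  by move=> c hc; rewrite !polarE (polarA symA) hmu // !polarE; ring.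
pose e := X - mu *: x.
have cP c : peirce x c -> e ** c = c ** e.
  move=> hc; rewrite /e !smulE (peirce_Xmul symA) // (peirce_mulX symA) //.
  by rewrite !(hmu _ hc) smulZr (hmu _ hc); case: hc => -> _; rewrite scaler0
    subr0 sub0r.
have cO d : oppeirce x d -> e ** d = d ** e.
  move=> hd; rewrite /e !smulE (oppeirce_Xmul symA) // (oppeirce_mulX symA) //.
  by rewrite !(hmu' _ hd) smulZl (hmu' _ hd); case: hd => -> _; rewrite scaler0
    subr0 sub0r.
have cx : e ** x = x ** e.
  by rewrite /e !smulE (mul_xX symA hx) (mul_Xx symA hx).
have cX : e ** X = X ** e.
  by rewrite /e !smulE (mul_xX symA hx) (mul_Xx symA hx).
have ex : '[e, x] = 1 by rewrite /e !polarE (norm_xx hx) qpolarC (norm_xX hx)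
  mulr0 oppr0 addr0.
clearbody e.
have e0 : e = 0.
  apply: centA => w; rewrite (peirce_decomposition symA hx w).
  rewrite -[_ ** (x ** (x ** w))]opprK; rewrite !smulE cx cX.
  by rewrite cP ?cO //; [exact: oppeirce_mulx3 | exact: peirce_lmul3].
by move: ex; rewrite e0 qpolar0l => /eqP; rewrite eq_sym oner_eq0.
Qed.

End Skew.
End Fixed.
End CubicNonzero.

Section CubicForm.
Variables (F : fieldType) (A : quadAlg F).
Hypothesis symA : symmetric_composition A.
Hypothesis ndA : polar_nondegenerate A.
Hypothesis centA : centerless A.
Implicit Types a b c d w x : A.

Local Notation n := (qnorm A).
Local Notation g := (@cubic F A).

Lemma polar_cycle a b c : '[a, b ** c] = '[b, c ** a].
Proof. by rewrite -(polarA symA) (polarAdj symA). Qed.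

Lemma cubicD a b :
  g (a + b) = g a + 3%:R * '[b, a ** a] + 3%:R * '[a, b ** b] + g b.
Proof.
have e1 : '[a, b ** a] = '[b, a ** a] := polar_cycle a b a.
have e2 : '[a, a ** b] = '[b, a ** a] := esym (polar_cycle b a a).
have e3 : '[b, a ** b] = '[a, b ** b] := polar_cycle b a b.
have e4 : '[b, b ** a] = '[a, b ** b] := esym (polar_cycle a b b).
by rewrite /cubic !smulE !polarE e1 e2 e3 e4; ring.
Qed.

Lemma cubicD3 a b c :
  g (a + b + c) - g (a + b) - g (b + c) - g (a + c) + g a + g b + g c
  = 3%:R * '[a, b ** c + c ** b].
Proof.
have e2 : '[c, a ** b] = '[a, b ** c] := polar_cycle c a b.
have e4 : '[c, b ** a] = '[a, c ** b] := esym (polar_cycle a c b).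
by rewrite !cubicD !smulE !polarE e2 e4; ring.
Qed.

(** If g vanished on [peirce x], so would its full polarization; dividing by 3 gives the hypothesis
    of [skew_false]. *)
Lemma cubic_neq0_not3 x : normalized x -> 3%:R != 0 :> F ->
  exists2 v, peirce x v & g v != 0.
Proof.
move=> hx ch3; apply: contrapT => H.
have g0 v : peirce x v -> g v = 0.
  by move=> hv; apply/eqP/negPn/negP => gv; apply: H; exists v.
apply: (skew_false symA ndA centA hx) => a b c ha hb hc.
apply: (mulfI ch3); rewrite -cubicD3 mulr0 !g0 //; first by ring.
all: by do ?apply: peirceD.
Qed.

(** * Characteristic 3 *)

Section Char3.
Hypothesis ch3 : 3%:R = 0 :> F.

Lemma cubicD_char3 a b : g (a + b) = g a + g b.
Proof. by rewrite cubicD ch3; ring. Qed.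

Lemma cubicN a : g (- a) = - g a.
Proof. by rewrite -scaleN1r cubicZ; ring. Qed.

Lemma cube_inj_char3 : injective (fun k : F => k ^+ 3).
Proof.
move=> k l /= E; have : (k - l) ^+ 3 = 0.
  transitivity (k ^+ 3 - l ^+ 3 - 3%:R * (k * l * (k - l))); first by ring.
  by rewrite E ch3; ring.
by move/eqP; rewrite expf_eq0 /= subr_eq0 => /eqP.
Qed.

(** Here g and cubing are additive, so g is computed on each term of the decomposition, and only
    those along x and x x contribute. *)
Lemma cubic_char3 x : normalized x -> (forall v, peirce x v -> g v = 0) ->
  (forall v, peirce (x ** x) v -> g v = 0) ->
  forall w, g w = '[w, x + x ** x] ^+ 3.
Proof.
move=> hx H1 H2 w; set X := x ** x.
rewrite {1}(peirce_decomposition symA hx w) !cubicD_char3 !cubicN !cubicZ.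
rewrite (H1 _ (peirce_lmul3 symA hx w)).
have hO := oppeirce_mulx3 symA hx w.
(* [oppeirce x] is contained in [peirce (x ** x)], so the second vanishing hypothesis covers this
   term. *)
rewrite (H2 (((w ** x) ** x) ** x)); last first.
  by split; [exact: oppeirce_mulX | exact: (oppeirce_polarX symA)].
case: hx (normalized_sqr symA hx) => _ -> [_ ->]; rewrite polarE -/X.
have -> (k l : F) : (k + l) ^+ 3 = k ^+ 3 + l ^+ 3 + 3%:R * (k * l * (k + l))
  by ring.
by rewrite ch3; ring.
Qed.

(* If the cubic form vanished on peirce x for every normalized x, then
   c = x + x ** x would not depend on x and would commute with every
   normalized element, hence be central. *)
Lemma cubic_neq0_char3 : (exists x, normalized x) ->
  (forall a b, exists h, [/\ h != 0, n h = 0, '[h, a] = 0 & '[h, b] = 0]) ->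
  exists2 x, normalized x & exists2 v, peirce x v & g v != 0.
Proof.
move=> [x0 hx0] isoA; apply: contrapT => H.
have g0 x v : normalized x -> peirce x v -> g v = 0.
  move=> hx hv; apply/eqP/negPn/negP => gv; apply: H; exists x => //.
  by exists v.
pose c := x0 + x0 ** x0.
have gE x : normalized x -> forall w, g w = '[w, x + x ** x] ^+ 3.
  move=> hx; apply: cubic_char3 => // v; apply: g0 => //.
  exact: normalized_sqr.
(* Both sides pair with any w to a cube root of g(w). Cube roots are unique here and the polar form
   is nondegenerate. *)
have cE x : normalized x -> x + x ** x = c.
  move=> hx; apply/eqP; rewrite -subr_eq0; apply/eqP; apply: ndA => w.
  rewrite qpolarC qpolarDr qpolarNr; apply/eqP; rewrite subr_eq0; apply/eqP.
  by apply: cube_inj_char3; rewrite /= -!gE.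
have comm x : normalized x -> c ** x = x ** c.
  by move=> hx; rewrite -(cE x hx) !smulE (mul_xX symA hx) (mul_Xx symA hx).
pose X0 := x0 ** x0.
have commD a b : c ** a = a ** c -> c ** b = b ** c ->
    c ** (a + b) = (a + b) ** c.
  by rewrite smulDr smulDl => -> ->.
(* For such h the element x0 + h is again normalized, because g(h) = n(h, c)^3 = 0. *)
have commI h : n h = 0 -> '[h, x0] = 0 -> '[h, X0] = 0 -> c ** h = h ** c.
  move=> nh hx hX.
  have h1 : normalized (x0 + h).
    split; first by rewrite qnormD nh (proj1 hx0) qpolarC hx; ring.
    rewrite -[RHS](proj2 hx0) cubicD_char3 (gE _ hx0 h) !polarE hx hX; ring.
  by move: (comm _ h1); rewrite smulDr smulDl (comm _ hx0) => /addrI.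
have [h [h0 nh hx hX]] := isoA x0 X0.
have [w1 [w1x w1X hw1]] : exists w, [/\ '[w, x0] = 0, '[w, X0] = 0 & '[h, w] !=
  0].
  have [w hw] : exists w, '[h, w] != 0.
    apply: contrapT => Hw; case/eqP: h0; apply: ndA => w.
    by apply/eqP/negPn/negP => hw; apply: Hw; exists w.
  (* Projecting away from x0 and X0 leaves the pairing with h unchanged. *)
  exists (w - '[w, X0] *: x0 - '[w, x0] *: X0).
  rewrite !polarE (norm_xx hx0) (qpolarC X0) (norm_xX hx0) (norm_XX symA hx0).
  by rewrite hx hX; split; [ring | ring | rewrite !mulr0 !oppr0 !addr0].
(* Subtracting (n(w) / n(h, w)) h makes w isotropic, so that [commI] applies to both summands. *)
have commP1 w : '[w, x0] = 0 -> '[w, X0] = 0 -> '[h, w] != 0 -> c ** w = w ** c.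
  move=> wx wX hw; rewrite -(subrK ((n w / '[h, w]) *: h) w).
  apply: commD; last by rewrite smulZl smulZr commI.
  apply: commI; rewrite ?polarE ?wx ?wX ?hx ?hX ?mulr0 ?subr0 //.
  rewrite qnormD -scaleN1r !qnormZ nh !polarE (qpolarC w).
  by field.
have commP w : '[w, x0] = 0 -> '[w, X0] = 0 -> c ** w = w ** c.
  move=> wx wX; have [hw|hw] := eqVneq '[h, w] 0; last exact: commP1.
  (* If w is orthogonal to h, then w = (w + w1) - w1, and neither of these terms is. *)
  rewrite -(addrK w1 w) -scaleN1r; apply: commD; last first.
    by rewrite smulZl smulZr commP1.
  by apply: commP1; rewrite polarE ?wx ?wX ?w1x ?w1X ?hw ?add0r.
have c0 : c = 0.
  apply: centA => w.
  have Ew : w = (w - '[w, X0] *: x0 - '[w, x0] *: X0) + '[w, X0] *: x0 + '[w,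
    x0] *: X0.
    by rewrite [X in X + _]addrAC !subrK.
  rewrite Ew; apply: (commD); last first.
    by rewrite smulZl smulZr comm //; exact: normalized_sqr.
  apply: (commD); last by rewrite smulZl smulZr comm.
  apply: commP; rewrite !polarE ?(norm_xx hx0) ?(qpolarC X0) (norm_xX hx0)
    ?(norm_XX symA hx0); ring.
have : '[c, x0] = 1 by rewrite polarE (norm_xx hx0) qpolarC (norm_xX hx0) add0r.
by rewrite c0 qpolar0l => /eqP; rewrite eq_sym oner_eq0.
Qed.

End Char3.
End CubicForm.

(** * Multiplication table of a normalized pair *)

Section PeirceTable.
Variables (F : fieldType) (A : quadAlg F).
Hypothesis symA : symmetric_composition A.
Implicit Types a b c d w x : A.

Local Notation n := (qnorm A).
Local Notation g := (@cubic F A).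

(** All products among y, x y and x (x y) reduce to y y and its images under right multiplication by
    x. *)
Lemma peirce_table x y : normalized x -> peirce x y ->
  (y ** (x ** y) = 0) * ((x ** y) ** y = - ((y ** y) ** x)) *
  ((x ** y) ** (x ** y) = ((y ** y) ** x) ** x) *
  (y ** (x ** (x ** y)) = - (((y ** y) ** x) ** x)) *
  ((x ** y) ** (x ** (x ** y)) = 0) * ((x ** (x ** y)) ** y = 0) *
  ((x ** (x ** y)) ** (x ** y) = y ** y) *
  ((x ** (x ** y)) ** (x ** (x ** y)) = - ((y ** y) ** x)).
Proof.
move=> hx hy; have hb1 := peirce_xmul symA hx hy.
have hb2 := peirce_xmul symA hx hb1.
have e1 : y ** (x ** y) = 0 by rewrite (smulVK symA) (peirce_norm symA hx)
  ?scale0r.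
have e2 : (x ** y) ** y = - ((y ** y) ** x) by rewrite (peirce_mul_x symA _ hy).
have e3 : (x ** y) ** (x ** y) = ((y ** y) ** x) ** x.
  by rewrite (peirce_mul_x symA _ hb1) e2 smulNl opprK.
have e4 : (x ** (x ** y)) ** (x ** y) = y ** y.
  rewrite (peirce_mul_x symA _ hb1) e3.
  by rewrite (oppeirce_x3 symA hx) ?opprK //; exact: peirce_mul.
do !split=> //.
- by rewrite (peirce_x_mul symA hx hy hb1) e3.
- by rewrite (smulVK symA) (peirce_norm symA hx) ?scale0r.
- by rewrite (peirce_mul_x symA _ hy) e1 smul0l oppr0.
- by rewrite (peirce_mul_x symA _ hb2) e4.
Qed.

End PeirceTable.

Section Frame.
Variables (F : fieldType) (A : quadAlg F).
Hypothesis symA : symmetric_composition A.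
Implicit Types a b c d w x : A.

Local Notation n := (qnorm A).
Local Notation g := (@cubic F A).

Variables x y : A.
Hypotheses (hx : normalized x) (hy : peirce x y).
Let X := x ** x.
Let Y := y ** y.
Let b1 := x ** y.
Let b2 := x ** b1.
Let d1 := Y ** x.
Let d2 := d1 ** x.

Let hb1 : peirce x b1. Proof. exact: peirce_xmul. Qed.
Let hb2 : peirce x b2. Proof. exact: peirce_xmul. Qed.
Let hY : oppeirce x Y. Proof. exact: peirce_mul. Qed.
Let hd1 : oppeirce x d1. Proof. exact: oppeirce_mulx. Qed.
Let hd2 : oppeirce x d2. Proof. exact: oppeirce_mulx. Qed.
Let Vtab := peirce_table symA hx hy.

Lemma frame_mul_YY : Y ** Y = g y *: y.
Proof. by rewrite (smul_sqr symA) (peirce_norm symA hx hy) scale0r subr0. Qed.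

Lemma frame_xmul : (x ** b2 = - y) * (b2 ** X = b1) * (b1 ** X = y) * (y ** X =
  - b2) *
  (d2 ** x = - Y) * (X ** d2 = d1) * (X ** d1 = Y) * (X ** Y = - d2).
Proof.
have e1 : x ** b2 = - y := peirce_x3 symA hx hy.
have e2 : d2 ** x = - Y := oppeirce_x3 symA hx hY.
have V b : peirce x b -> b ** X = - (x ** (x ** b)) := @peirce_mulX F A symA x
  b.
have O d : oppeirce x d -> X ** d = - ((d ** x) ** x) := @oppeirce_Xmul F A
  symA x d.
do !split=> //; try by rewrite V // -/b1 -/b2 e1 ?smulNr opprK.
all: by rewrite O // -/d1 -/d2 e2 ?smulNl opprK.
Qed.

Lemma frame_polar :
  ('[Y, y] = g y) * ('[Y, b1] = 0) * ('[Y, b2] = 0) *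
  ('[d1, y] = 0) * ('[d1, b1] = 0) * ('[d1, b2] = - g y) *
  ('[d2, y] = 0) * ('[d2, b1] = - g y) * ('[d2, b2] = 0).
Proof.
have e1 : '[Y, y] = g y by rewrite qpolarC.
have e2 : '[Y, b1] = 0 by rewrite (polarA symA) !Vtab qpolar0r.
have e3 : '[Y, b2] = 0 by rewrite qpolarC -(polarA symA) !Vtab qpolar0l.
have e4 : '[d1, b2] = - g y by rewrite (polarA symA) frame_xmul qpolarNr e1.
have e5 : '[d1, y] = 0 by rewrite (polarA symA).
have e6 : '[d1, b1] = 0 by rewrite (polarA symA).
by do !split=> //; rewrite (polarA symA) ?frame_xmul ?qpolarNr ?e5 ?oppr0.
Qed.

(** The second factor is the determinant of the circulant matrix with entries k, -l, m. *)
Lemma cubic_frame (k l m : F) :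
  g (k *: y + l *: b1 + m *: b2) =
  g y * (k ^+ 3 - l ^+ 3 + m ^+ 3 + 3%:R * (k * l * m)).
Proof.
rewrite /cubic !smulE !Vtab -/b1 -/b2 -/Y -/d1 -/d2 !polarE.
by rewrite ![ '[_, d1] ]qpolarC ![ '[_, d2] ]qpolarC ![ '[_, Y] ]qpolarC
  !frame_polar; ring.
Qed.

(** This is [peirce_table] in the opposite algebra, applied to x and y y, with the factors in
    reverse order. *)
Let Otab : (d1 ** Y = 0) * (Y ** d1 = - (x ** (Y ** Y))) *
  (d1 ** d1 = x ** (x ** (Y ** Y))) * (d2 ** Y = - (x ** (x ** (Y ** Y)))) *
  (d2 ** d1 = 0) * (Y ** d2 = 0) * (d1 ** d2 = Y ** Y) *
  (d2 ** d2 = - (x ** (Y ** Y))).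
Proof. exact (@peirce_table F (opAlg A) (opAlg_symmetric symA) x Y hx hY). Qed.

Hypothesis gy : g y = 1.

Lemma frame_mul_peirce :
  (y ** y = Y) * (y ** b1 = 0) * (y ** b2 = - d2) *
  (b1 ** y = - d1) * (b1 ** b1 = d2) * (b1 ** b2 = 0) *
  (b2 ** y = 0) * (b2 ** b1 = Y) * (b2 ** b2 = - d1).
Proof. by do !split; rewrite ?Vtab. Qed.

Lemma frame_mul_oppeirce :
  (Y ** Y = y) * (Y ** d1 = - b1) * (Y ** d2 = 0) *
  (d1 ** Y = 0) * (d1 ** d1 = b2) * (d1 ** d2 = y) *
  (d2 ** Y = - b2) * (d2 ** d1 = 0) * (d2 ** d2 = - b1).
Proof.
have e : Y ** Y = y by rewrite frame_mul_YY gy scale1r.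
by do !split; rewrite ?Otab ?e.
Qed.

Lemma frame_mul_OV :
  (Y ** y = 0) * (Y ** b1 = x) * (Y ** b2 = 0) *
  (d1 ** y = x) * (d1 ** b1 = 0) * (d1 ** b2 = 0) *
  (d2 ** y = 0) * (d2 ** b1 = 0) * (d2 ** b2 = - x).
Proof.
do !split; rewrite (oppeirce_mul symA hx) // -/X ?frame_xmul ?qpolarNr
  ?frame_polar;
  by rewrite ?gy ?opprK ?oppr0 ?scale0r ?scaleN1r ?scale1r.
Qed.

Lemma frame_mul_VO :
  (y ** Y = 0) * (y ** d1 = 0) * (y ** d2 = - X) *
  (b1 ** Y = 0) * (b1 ** d1 = - X) * (b1 ** d2 = 0) *
  (b2 ** Y = - X) * (b2 ** d1 = 0) * (b2 ** d2 = 0).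
Proof.
do !split; rewrite (peirce_mul_oppeirce symA hx) // -/X ?frame_xmul ?qpolarNr
  ?qpolarNl ?frame_polar;
  by rewrite ?gy ?opprK ?oppr0 ?scale0r ?scaleN1r ?scale1r.
Qed.

Lemma frame_mul_x :
  (x ** x = X) * (x ** X = 0) * (X ** x = 0) * (X ** X = x) *
  (x ** y = b1) * (x ** b1 = b2) * (x ** b2 = - y) *
  (x ** Y = 0) * (x ** d1 = 0) * (x ** d2 = 0) *
  (y ** x = 0) * (b1 ** x = 0) * (b2 ** x = 0) *
  (Y ** x = d1) * (d1 ** x = d2) * (d2 ** x = - Y) *
  (X ** y = 0) * (X ** b1 = 0) * (X ** b2 = 0) *
  (X ** Y = - d2) * (X ** d1 = Y) * (X ** d2 = d1) *
  (y ** X = - b2) * (b1 ** X = y) * (b2 ** X = b1) *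
  (Y ** X = 0) * (d1 ** X = 0) * (d2 ** X = 0).
Proof.
have V b : peirce x b -> X ** b = 0 := @peirce_Xmul F A symA x b.
have O d : oppeirce x d -> d ** X = 0 := @oppeirce_mulX F A symA x d.
have V0 b : peirce x b -> b ** x = 0 by case.
have O0 d : oppeirce x d -> x ** d = 0 by case.
do !split=> //; try by rewrite frame_xmul.
all: try by [exact: V | exact: O | exact: V0 | exact: O0].
- exact: mul_xX.
- exact: mul_Xx.
- exact: mul_XX.
Qed.

End Frame.

Section OkuboBasis.
Variable F : fieldType.
Local Notation O := {ffun oindex -> F^o}.

Lemma okubo_sum (u : O) : u = \sum_(p : oindex) u p *: oz F (val p).
Proof.
apply/ffunP=> k; rewrite sum_ffunE (bigD1 k) //= !ffunE eqxx.
rewrite big1 ?addr0; first exact: esym (mulr1 _).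
by move=> p /negPf np; rewrite !ffunE val_eqE eq_sym np; apply: mulr0.
Qed.

Lemma okubo_linear_ext (V : lmodType F) (f h : O -> V) :
  linear f -> linear h ->
  (forall p : oindex, f (oz F (val p)) = h (oz F (val p))) -> f =1 h.
Proof.
move=> lf lh fh u.
pose F1 := GRing.isLinear.Build _ _ _ _ f lf.
pose F2 := GRing.isLinear.Build _ _ _ _ h lh.
pose f' : {linear O -> V} := HB.pack f F1.
pose h' : {linear O -> V} := HB.pack h F2.
rewrite -[LHS]/(f' u) -[RHS]/(h' u) (okubo_sum u) !linear_sum.
by apply: eq_bigr => p _; rewrite !linearZ; congr (_ *: _); exact: fh.
Qed.

(** Intended for quadratic maps: equal polarizations make [f - h] additive, so agreement on
    multiples of basis vectors suffices, in characteristic 2 as well. *)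
Lemma okubo_additive_ext (V : zmodType) (f h : O -> V) :
  f 0 = h 0 -> (forall u v, f (u + v) - h (u + v) = f u - h u + (f v - h v)) ->
  (forall k (p : oindex), f (k *: oz F (val p)) = h (k *: oz F (val p))) -> f
    =1 h.
Proof.
move=> f0 fD fZ u; apply/eqP; rewrite -subr_eq0; apply/eqP.
rewrite (okubo_sum u); elim: (index_enum _) => [|p r IH].
  by rewrite big_nil f0 subrr.
by rewrite big_cons fD IH fZ subrr addr0.
Qed.

Lemma opolar_ozr (u : O) (p q : oindex) : val p + val q = 0 ->
  opolar u (oz F (val q)) = u p.
Proof.
move=> pq; rewrite /opolar (bigD1 p) //= (bigD1 q) //= !ffunE pq !eqxx mulr1.
rewrite !big1 ?addr0 // => [p' np | q' nq].
  rewrite big1 // => q' _; rewrite ffunE; case: eqP => [/val_inj ->|_]; last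
    first.
    by rewrite mulr0 mul0rn.
  by rewrite -[X in _ == X]pq (inj_eq (addIr _)) val_eqE (negPf np).
by rewrite ffunE val_eqE (negPf nq) mulr0 mul0rn.
Qed.

End OkuboBasis.

(** * The isometric embedding of the split Okubo algebra given by a normalized pair *)

Section Frame.
Variables (F : fieldType) (A : quadAlg F).
Hypothesis symA : symmetric_composition A.
Local Notation n := (qnorm A).
Local Notation g := (@cubic F A).
Local Notation O := {ffun oindex -> F^o}.

Variables x y : A.
Hypotheses (hx : normalized x) (hy : peirce x y) (gy : g y = 1).

(** The images of the z_(i,j) when z_(1,0) goes to x and z_(0,1) to y. The signs are forced by the
    products with Delta = 1, such as z_(1,0) z_(0,1) = - z_(1,1). The value 0 at (0, 0) agrees with
    z_0 = 0. *)
Definition frame_code (i j : nat) : A :=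
  match i, j with
  | 1%N, 0%N => x
  | 2%N, 0%N => x ** x
  | 0%N, 1%N => y
  | 0%N, 2%N => y ** y
  | 1%N, 1%N => - (x ** y)
  | 2%N, 1%N => x ** (x ** y)
  | 1%N, 2%N => - ((y ** y) ** x)
  | 2%N, 2%N => ((y ** y) ** x) ** x
  | _, _ => 0
  end.

Definition frame (p : 'Z_3 * 'Z_3) : A := frame_code p.1 p.2.

Definition frame_map (u : O) : A := \sum_(p : oindex) u p *: frame (val p).

Lemma frame_map_linear : linear frame_map.
Proof.
move=> a u v; rewrite /frame_map scaler_sumr -big_split; apply: eq_bigr => p _
  /=.
by rewrite !ffunE scalerDl scalerA.
Qed.

HB.instance Definition _ :=
  GRing.isLinear.Build F O A *:%R frame_map frame_map_linear.

Lemma frame_map_oz p : frame_map (oz F p) = frame p.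
Proof.
have [->|p0] := eqVneq p 0.
  rewrite /frame_map big1 // => k _; rewrite ffunE; case: eqP => [E|_].
    by have := valP k; rewrite E eqxx.
  exact: scale0r.
rewrite /frame_map (bigD1 (Sub p p0 : oindex)) //= ffunE eqxx scale1r.
rewrite big1 ?addr0 // => k nk; rewrite ffunE; case: eqP => [E|_].
  by case/eqP: nk; apply: val_inj.
exact: scale0r.
Qed.

Lemma frame_mul (p q : 'Z_3 * 'Z_3) : p != 0 -> q != 0 ->
  frame p ** frame q = frame_map (oz_mul F p q).
Proof.
have [[[[[[[[VV1 VV2] VV3] VV4] VV5] VV6] VV7] VV8] VV9] := frame_mul_peirce
  symA hx hy.
have [[[[[[[[OO1 OO2] OO3] OO4] OO5] OO6] OO7] OO8] OO9] := frame_mul_oppeirce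
  symA hx hy gy.
have [[[[[[[[OV1 OV2] OV3] OV4] OV5] OV6] OV7] OV8] OV9] := frame_mul_OV symA
  hx hy gy.
have [[[[[[[[VO1 VO2] VO3] VO4] VO5] VO6] VO7] VO8] VO9] := frame_mul_VO symA
  hx hy gy.
have := frame_mul_x symA hx hy; do 27!case; move=> X1 X2 X3 X4 X5 X6 X7 X8 X9
  X10 X11 X12 X13 X14 X15 X16 X17 X18 X19 X20 X21 X22 X23 X24 X25 X26 X27 X28
    p0 q0.
rewrite /oz_mul 2!(fun_if frame_map) linear0 linearN /= !frame_map_oz.
case: ifP => c; last (case: ifP => c'; move: c'); move: c.
all: case: p p0 => [[[|[|[|//]]] ?] [[|[|[|//]]] ?]] p0;
  try by vm_compute in p0.
all: case: q q0 => [[[|[|[|//]]] ?] [[|[|[|//]]] ?]] q0;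
  try by vm_compute in q0.
all: try by (let c := fresh in move=> c; vm_compute in c).
all: try by (let c := fresh in move=> _ c; vm_compute in c).
(* Evaluating p + q makes the right side an explicit [frame_code]; each remaining case is, up to
   sign, an entry of the tables. *)
all: move=> *; try match goal with |- context [frame (?p + ?q)] =>
    let i := eval vm_compute in (nat_of_ord (p + q).1) in
    let j := eval vm_compute in (nat_of_ord (p + q).2) in
    change (frame (p + q)) with (frame_code i j) end.
all: rewrite /frame /frame_code /= ?smulNl ?smulNr ?opprK; first [assumption |
  by apply/eqP; rewrite eqr_oppLR ?oppr0 ?opprK; apply/eqP].
Qed.

Lemma frame_mapM u v : frame_map (okubo_mul u v) = frame_map u ** frame_map v.
Proof.
rewrite /okubo_mul linear_sum [frame_map u]/frame_map linear_sumlz; apply: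
  eq_bigr => p _.
rewrite linear_sum /= [frame_map v]/frame_map linear_sumr; apply: eq_bigr => q
  _.
by rewrite linearZ /= -(frame_mul (valP p) (valP q)) smulZl smulZr scalerA.
Qed.

Lemma frame_norm p : n (frame p) = 0.
Proof.
have hb1 := peirce_xmul symA hx hy; have nx : n x = 0 by case: hx.
have hb2 := peirce_xmul symA hx hb1.
case: p => [[[|[|[|//]]] ?] [[|[|[|//]]] ?]]; rewrite /frame /frame_code /=
  ?qnorm0 //.
all: rewrite -?scaleN1r ?qnormZ ?(qnormM symA) ?nx ?(peirce_norm symA hx hy)
  ?mul0r ?mulr0 //.
Qed.

Lemma frame_polarE (p q : 'Z_3 * 'Z_3) : p != 0 -> q != 0 ->
  '[frame p, frame q] = (p + q == 0)%:R.
Proof.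
have hb1 := peirce_xmul symA hx hy; have hb2 := peirce_xmul symA hx hb1.
have hY := peirce_mul symA hy hy; have hd1 := oppeirce_mulx symA hx hY.
have hd2 := oppeirce_mulx symA hx hd1; have hE := frame_polar symA hx hy.
have xx := (norm_xx hx, norm_XX symA hx, norm_xX hx).
have Vx b : peirce x b -> '[b, x] = 0 by case.
have Ox d : oppeirce x d -> '[d, x] = 0 by case.
have VX b : peirce x b -> '[b, x ** x] = 0 := @peirce_polarX F A symA x b.
have OX d : oppeirce x d -> '[d, x ** x] = 0 := @oppeirce_polarX F A symA x d.
have VV b c : peirce x b -> peirce x c -> '[b, c] = 0 := @peirce_polar F A symA
  x hx b c.
have OO d e : oppeirce x d -> oppeirce x e -> '[d, e] = 0 := @oppeirce_polar F
  A symA x hx d e.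
case E : (p + q == 0); move: E.
all: case: p => [[[|[|[|//]]] ?] [[|[|[|//]]] ?]] E p0; try by vm_compute in p0.
all: move: E; case: q => [[[|[|[|//]]] ?] [[|[|[|//]]] ?]] E q0; try by
  vm_compute in q0.
all: try by vm_compute in E.
all: rewrite /frame /frame_code /= ?qpolarNl ?qpolarNr ?opprK ?mulr1n ?mulr0n
  {E}.
all: try first [apply/eqP; rewrite oppr_eq0; apply/eqP | idtac].
all: first [by rewrite ?hE ?xx ?gy ?opprK ?oppr0 | by rewrite qpolarC ?hE ?xx
  ?gy ?opprK ?oppr0
 | by first [exact: Vx | exact: Ox | exact: VX | exact: OX | exact: VV | exact:
   OO]
 | by rewrite qpolarC; first [exact: Vx | exact: Ox | exact: VX | exact: OX |
   exact: VV | exact: OO] ].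
Qed.

Lemma frame_map_polar u v : '[frame_map u, frame_map v] = opolar u v.
Proof.
rewrite [frame_map u]/frame_map linear_sumlz; apply: eq_bigr => p _.
rewrite [frame_map v]/frame_map linear_sumr; apply: eq_bigr => q _.
by rewrite /= !polarE frame_polarE ?(valP p) ?(valP q) // mulrA mulr_natr.
Qed.

(** Both norms have the same polar form and vanish on multiples of basis vectors. *)
Lemma frame_map_norm u : n (frame_map u) = okubo_norm u.
Proof.
apply: (okubo_additive_ext (f := n \o frame_map) (h := @okubo_norm F)) => /=.
- by rewrite linear0 qnorm0 /okubo_norm big1 // => p _; rewrite big1 // => q _;
     rewrite ffunE mul0r mul0rn.
- move=> v w; have := okubo_polarE v w; rewrite /polar -frame_map_polar => E.
  by rewrite linearD qnormD -E; ring.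
- move=> k p; rewrite linearZ /= qnormZ frame_map_oz frame_norm mulr0.
  by rewrite (proj1 (okubo_norm_quadratic F)) okubo_norm_oz mulr0.
Qed.

(** The coordinate of u at p is the pairing of u with z_(-p), and [frame_map] preserves pairings. *)
Lemma frame_map_inj : injective frame_map.
Proof.
apply: raddf_inj => u fu; apply/ffunP => p; rewrite ffunE.
have np : - val p != 0 by rewrite oppr_eq0 (valP p).
rewrite -(@opolar_ozr F u p (Sub (- val p) np)); last by rewrite /= subrr.
by rewrite -frame_map_polar fu qpolar0l.
Qed.

End Frame.

(** * Identities of the split Okubo algebra *)

Section OkuboSign.
Implicit Types p q r : 'Z_3 * 'Z_3.

(** Integral structure constants: z_p z_q = [okubo_sign p q] z_(p+q), also when p or q is 0.
    Identities among them are decided by computation, independently of the field. *)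
Definition okubo_sign p q : int :=
  if [|| p == 0, q == 0, odelta p q == 2%:R | p + q == 0] then 0
  else if odelta p q == 1 then -1 else 1.

Definition okubo_points : seq ('Z_3 * 'Z_3) :=
  [seq (inZp i, inZp j) | i <- iota 0 3, j <- iota 0 3].

Lemma okubo_points_all3 (P : 'Z_3 * 'Z_3 -> 'Z_3 * 'Z_3 -> 'Z_3 * 'Z_3 -> bool)
  :
  all (fun p => all (fun q => all (P p q) okubo_points) okubo_points)
    okubo_points ->
  forall p q r, P p q r.
Proof.
have mem p : p \in okubo_points.
  by case: p => [[[|[|[|//]]] ?] [[|[|[|//]]] ?]].
by move=> /allP H p q r; have /allP/(_ q (mem q))/allP/(_ r (mem r)) := H p
  (mem p).
Qed.

(** These are the coefficients of z_(p+q+r) in [smulACl] on basis vectors; when p + q + r = 0 that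
    vector is zero. *)
Lemma okubo_sign_mulK p q r : p + q + r != 0 ->
  okubo_sign p q * okubo_sign (p + q) r + okubo_sign r q * okubo_sign (r + q) p
  = [&& p != 0, r != 0, q != 0 & p + r == 0]%:Z.
Proof.
move=> nz; apply/eqP; apply/implyP: nz; move: p q r.
by apply: okubo_points_all3; vm_compute.
Qed.

Lemma okubo_sign_mulVK p q r : p + q + r != 0 ->
  okubo_sign q r * okubo_sign p (q + r) + okubo_sign q p * okubo_sign r (q + p)
  = [&& p != 0, r != 0, q != 0 & p + r == 0]%:Z.
Proof.
move=> nz; apply/eqP; apply/implyP: nz; move: p q r.
by apply: okubo_points_all3; vm_compute.
Qed.

Lemma okubo_sign_assoc p q r : p + q + r = 0 -> p != 0 -> r != 0 ->
  okubo_sign p q = okubo_sign q r.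
Proof.
move=> s0 p0 r0; suff : [==> p + q + r == 0, p != 0, r != 0 => okubo_sign p q
  == okubo_sign q r].
  by rewrite s0 eqxx p0 r0 => /eqP.
by move: p q r {s0 p0 r0}; apply: okubo_points_all3; vm_compute.
Qed.

Lemma okubo_sign_mulKxx p q : okubo_sign p q * okubo_sign (p + q) p = 0.
Proof.
pose P p q (_ : 'Z_3 * 'Z_3) := okubo_sign p q * okubo_sign (p + q) p == 0.
by apply/eqP; apply: (@okubo_points_all3 P _ p q 0); vm_compute.
Qed.

Lemma okubo_sign_mulVKxx p q : okubo_sign q p * okubo_sign p (q + p) = 0.
Proof.
pose P p q (_ : 'Z_3 * 'Z_3) := okubo_sign q p * okubo_sign p (q + p) == 0.
by apply/eqP; apply: (@okubo_points_all3 P _ p q 0); vm_compute.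
Qed.

(** For r = - (p + q), the coefficients of z_(-p) in z_q z_r and z_r z_q differ by 1 or -1, which is
    nonzero in every field. *)
Lemma okubo_sign_noncomm p : p != 0 -> exists q,
  `|okubo_sign q (- (p + q)) - okubo_sign (- (p + q)) q|%N = 1%N.
Proof.
pose P p (_ _ : 'Z_3 * 'Z_3) := (p != 0) ==> has (fun q =>
  `|okubo_sign q (- (p + q)) - okubo_sign (- (p + q)) q|%N == 1%N) okubo_points.
have /implyP H : P p 0 0 by apply: (@okubo_points_all3 P); vm_compute.
by move=> /H /hasP[q _ /eqP]; exists q.
Qed.

End OkuboSign.

Section SplitOkuboIdentities.
Variable K : fieldType.
Local Notation S := (split_okubo K).
Local Notation z := (oz K).
Local Notation "x ** y" := (qmul S x y) (at level 40, left associativity) :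
  ring_scope.
Local Notation "''[' x , y ]" := (@qpolar K S x y) : ring_scope.
Implicit Types p q r : 'Z_3 * 'Z_3.

Lemma oz0 : z 0 = 0.
Proof.
apply/ffunP=> k; rewrite !ffunE; case: eqP => // E.
by have := valP k; rewrite E eqxx.
Qed.

Lemma oz_mul_sign p q : z p ** z q = (okubo_sign p q)%:~R *: z (p + q).
Proof.
rewrite /okubo_sign; have [->|p0] := eqVneq p 0.
  by rewrite oz0 smul0l scale0r.
have [->|q0] := eqVneq q 0; first by rewrite oz0 smul0r scale0r.
rewrite /= -[LHS]/(okubo_mul _ _).
rewrite (@okubo_mul_oz K (Sub p p0) (Sub q q0)) /= /oz_mul.
case: ifP => _; first by rewrite scale0r.
by case: ifP => _; rewrite ?scaleN1r ?scale1r.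
Qed.

Lemma oz_polar p q : '[z p, z q] = ((p != 0) && (p + q == 0))%:R.
Proof.
have [->|p0] := eqVneq p 0; first by rewrite oz0 qpolar0l.
have [->|q0] := eqVneq q 0; first by rewrite oz0 qpolar0r addr0 (negPf p0).
exact: (@opolar_oz K (Sub p p0) (Sub q q0)).
Qed.

Lemma oz_norm p : qnorm S (z p) = 0.
Proof.
have [->|p0] := eqVneq p 0; first by rewrite oz0 qnorm0.
exact: (@okubo_norm_oz K (Sub p p0)).
Qed.

Lemma split_mulACl (a b c : S) : (a ** b) ** c + (c ** b) ** a = '[a, c] *: b.
Proof.
move: a; apply: okubo_linear_ext => [k u v|k u v|p].
- by rewrite !smulE scalerDr addrACA.
- by rewrite !polarE scalerDl scalerA.
move: b; apply: okubo_linear_ext => [k u v|k u v|q].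
- by rewrite !smulE scalerDr addrACA.
- by rewrite scalerDr !scalerA mulrC.
move: c; apply: okubo_linear_ext => [k u v|k u v|r].
- by rewrite !smulE scalerDr addrACA.
- by rewrite !polarE scalerDl scalerA.
rewrite !oz_mul_sign !smulE !oz_mul_sign !scalerA -!intrM.
have -> : val r + val q + val p = val p + val q + val r.
  by rewrite addrC addrA addrAC (addrC _ (val r)) addrA addrAC.
rewrite -scalerDl -intrD oz_polar (valP p) /=.
have [s0|s0] := eqVneq (val p + val q + val r) 0.
  rewrite s0 oz0 scaler0; case: eqP => [E|_]; last by rewrite scale0r.
  by move: s0 (valP q); rewrite addrAC E add0r => ->; rewrite eqxx.
have p0 := valP p; have r0 := valP r; have q0 := valP q.
rewrite okubo_sign_mulK // p0 r0 q0 /=; case: eqP => [E|_]; last by rewrite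
  !scale0r.
by rewrite addrAC E add0r.
Qed.

Lemma split_mulACr (a b c : S) : a ** (b ** c) + c ** (b ** a) = '[a, c] *: b.
Proof.
move: a; apply: okubo_linear_ext => [k u v|k u v|p].
- by rewrite !smulE scalerDr addrACA.
- by rewrite !polarE scalerDl scalerA.
move: b; apply: okubo_linear_ext => [k u v|k u v|q].
- by rewrite !smulE scalerDr addrACA.
- by rewrite scalerDr !scalerA mulrC.
move: c; apply: okubo_linear_ext => [k u v|k u v|r].
- by rewrite !smulE scalerDr addrACA.
- by rewrite !polarE scalerDl scalerA.
rewrite !oz_mul_sign !smulE !oz_mul_sign !scalerA -!intrM.
have -> : val p + (val q + val r) = val p + val q + val r by rewrite addrA.
have -> : val r + (val q + val p) = val p + val q + val r.
  by rewrite addrC (addrC (val q)).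
rewrite -scalerDl -intrD oz_polar (valP p) /=.
have [s0|s0] := eqVneq (val p + val q + val r) 0.
  rewrite s0 oz0 scaler0; case: eqP => [E|_]; last by rewrite scale0r.
  by move: s0 (valP q); rewrite addrAC E add0r => ->; rewrite eqxx.
have p0 := valP p; have r0 := valP r; have q0 := valP q.
rewrite okubo_sign_mulVK // p0 r0 q0 /=; case: eqP => [E|_]; last by rewrite
  !scale0r.
by rewrite addrAC E add0r.
Qed.

Lemma split_polarA (a b c : S) : '[a ** b, c] = '[a, b ** c].
Proof.
move: a; apply: (@okubo_linear_ext K K^o) => [k u v|k u v|p].
- by rewrite !smulE !polarE.
- by rewrite !polarE.
move: b; apply: (@okubo_linear_ext K K^o) => [k u v|k u v|q].
- by rewrite !smulE !polarE.
- by rewrite !smulE !polarE.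
move: c; apply: (@okubo_linear_ext K K^o) => [k u v|k u v|r].
- by rewrite !polarE.
- by rewrite !smulE !polarE.
rewrite !oz_mul_sign !polarE !oz_polar (valP p) /= addrA.
have [s0|s0] := eqVneq (val p + val q + val r) 0; last by rewrite andbF !mulr0.
rewrite (okubo_sign_assoc s0 (valP p) (valP r)) andbT; congr (_ * _).
case: eqP => [E|//]; move: s0 (valP r); rewrite E add0r => -> //.
Qed.

Lemma oz_mulK p (b : S) : (z p ** b) ** z p = 0.
Proof.
move: b; apply: okubo_linear_ext => [k u v|k u v|q].
- by rewrite !smulE.
- by rewrite scaler0 addr0.
by rewrite oz_mul_sign smulE oz_mul_sign scalerA -intrM okubo_sign_mulKxx
  scale0r.
Qed.

Lemma oz_mulVK p (b : S) : z p ** (b ** z p) = 0.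
Proof.
move: b; apply: okubo_linear_ext => [k u v|k u v|q].
- by rewrite !smulE.
- by rewrite scaler0 addr0.
by rewrite oz_mul_sign smulE oz_mul_sign scalerA -intrM okubo_sign_mulVKxx
  scale0r.
Qed.

(** Both sides of the first two identities are quadratic in a with equal polarizations, and both
    vanish on multiples of basis vectors. *)
Lemma split_symmetric : symmetric_composition S.
Proof.
have zmodE (V : zmodType) (x y t w k l : V) :
    x + y + (t + w) - (k + l + (y + t)) = x - k + (w - l).
  rewrite (addrC t w) (addrACA x) opprD (addrACA (x + w)) subrr addr0.
  by rewrite opprD addrACA.
split; last exact: split_polarA.
- move=> a b; move: a; apply: okubo_additive_ext => [|u v|k p].
  + by rewrite !smulE qnorm0 scale0r.
  + rewrite qnormD !smulE 2!(scalerDl b _ _) -split_mulACl.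
    by rewrite (addrACA ((u ** b) ** u)) zmodE.
  + have H (w : S) : (w ** b) ** w = 0 -> qnorm S w = 0 ->
        ((k *: w) ** b) ** (k *: w) = qnorm S (k *: w) *: b.
      by move=> E nw; rewrite !smulE qnormZ nw E mulr0 scale0r !scaler0.
    exact: H (oz_mulK _ _) (oz_norm _).
- move=> a b; move: a; apply: okubo_additive_ext => [|u v|k p].
  + by rewrite !smulE qnorm0 scale0r.
  + by rewrite qnormD !smulE 2!(scalerDl b _ _) -split_mulACr zmodE.
  + have H (w : S) : w ** (b ** w) = 0 -> qnorm S w = 0 ->
        (k *: w) ** (b ** (k *: w)) = qnorm S (k *: w) *: b.
      by move=> E nw; rewrite !smulE qnormZ nw E mulr0 scale0r !scaler0.
    exact: H (oz_mulVK _ _) (oz_norm _).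
Qed.

Lemma split_nondegenerate : polar_nondegenerate S.
Proof.
move=> a H; apply/ffunP => p; rewrite ffunE.
have np : - val p != 0 by rewrite oppr_eq0 (valP p).
rewrite -(@opolar_ozr K a p (Sub (- val p) np)); last by rewrite /= subrr.
by rewrite -okubo_polarE; exact: H.
Qed.

Lemma split_centerless : centerless S.
Proof.
move=> a H; apply/ffunP => p; rewrite ffunE.
have [q hq] := okubo_sign_noncomm (valP p).
have np : - val p != 0 by rewrite oppr_eq0 (valP p).
set r := - (val p + q) in hq.
have ap : '[a, z (- val p)] = a p.
  rewrite -(@opolar_ozr K a p (Sub (- val p) np)); last by rewrite /= subrr.
  by rewrite -okubo_polarE.
(* By associativity of the polar form, commutation of a with z_q says that a is orthogonal to z_q
   z_r - z_r z_q, which is z_(-p) up to sign. *)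
have := congr1 (fun b => '[b, z r]) (H (z q)).
rewrite /= -[LHS]/('[a ** z q, z r]) -[RHS]/('[z q ** a, z r]).
rewrite split_polarA (polarAdj split_symmetric) !oz_mul_sign.
have -> : r + q = - val p by rewrite /r opprD subrK.
have -> : q + r = - val p by rewrite addrC /r opprD subrK.
rewrite !polarE ap => /eqP; rewrite -subr_eq0 -mulrBl -intrB mulf_eq0.
case/orP=> /eqP // E; move: hq E; case: (_ - _) => [m /= ->|[|m] //= _].
  by move/eqP; rewrite oner_eq0.
by move/eqP; rewrite oppr_eq0 oner_eq0.
Qed.

End SplitOkuboIdentities.

(** * The Chevalley-Warning theorem *)

Section ChevalleyWarning.
Variables (F : finFieldType) (I : finType).
Local Notation E := {ffun I -> F}.

(** Functions given by some polynomial of degree at most d. Only values matter for the sums below,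
    hence the closure under pointwise equality. *)
Inductive degree_le (d : nat) : (E -> F) -> Prop :=
| DegreeMonomial c (m : I -> nat) : (\sum_i m i <= d)%N ->
    degree_le d (fun a => c * \prod_i a i ^+ m i)
| DegreeAdd f h : degree_le d f -> degree_le d h ->
    degree_le d (fun a => f a + h a)
| DegreeExt f h : f =1 h -> degree_le d f -> degree_le d h.

Lemma degree_le_cst d c : degree_le d (fun=> c).
Proof.
apply: (@DegreeExt _ (fun a => c * \prod_i a i ^+ 0)).
  by move=> a; rewrite big1 ?mulr1 // => i _; rewrite expr0.
by apply: DegreeMonomial; rewrite big1.
Qed.

Lemma degree_le_var i : degree_le 1 (fun a => a i).
Proof.
apply: (@DegreeExt _ (fun a => 1 * \prod_j a j ^+ (j == i))).
  move=> a; rewrite mul1r (bigD1 i) //= eqxx big1 ?mulr1 // => j /negPf ->.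
  by rewrite expr0.
by apply: DegreeMonomial; rewrite (bigD1 i) //= eqxx big1 // => j /negPf ->.
Qed.

Lemma degree_le_mul d e f h : degree_le d f -> degree_le e h ->
  degree_le (d + e) (fun a => f a * h a).
Proof.
move=> df eh; elim: df => [c m md|f1 f2 _ IH1 _ IH2|f1 f2 f12 _ IH].
- elim: eh => [c' m' me|h1 h2 _ IH1 _ IH2|h1 h2 h12 _ IH].
  + apply: (@DegreeExt _ (fun a => (c * c') * \prod_i a i ^+ (m i + m' i))).
      move=> a; rewrite mulrACA -big_split /=; congr (_ * _).
      by apply: eq_bigr => i _; rewrite exprD.
    by apply: DegreeMonomial; rewrite big_split leq_add.
  + apply: DegreeExt (DegreeAdd IH1 IH2) => a.
    by rewrite mulrDr.
  + by apply: DegreeExt IH => a; rewrite h12.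
- by apply: DegreeExt (DegreeAdd IH1 IH2) => a; rewrite mulrDl.
- by apply: DegreeExt IH => a; rewrite f12.
Qed.

Lemma degree_le_exp d f k : degree_le d f ->
  degree_le (d * k) (fun a => f a ^+ k).
Proof.
move=> df; elim: k => [|k IH].
  exact: degree_le_cst.
by rewrite mulnS; apply: DegreeExt (degree_le_mul df IH) => a; rewrite exprS.
Qed.

Lemma degree_le_sum d (J : Type) (r : seq J) (f : J -> E -> F) :
  (forall j, degree_le d (f j)) -> degree_le d (fun a => \sum_(j <- r) f j a).
Proof.
move=> df; elim: r => [|j r IH].
  by apply: DegreeExt (degree_le_cst d 0) => a; rewrite big_nil.
by apply: DegreeExt (DegreeAdd (df j) IH) => a; rewrite big_cons.
Qed.

(** For k > 0 the polynomial X^k - 1 has at most k roots, so some b != 0 has b^k != 1; reindexing by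
    a -> b a multiplies the sum by b^k. *)
Lemma sum_expf (k : nat) : (k < #|F|.-1)%N -> \sum_(a : F) a ^+ k = 0.
Proof.
case: k => [|k] lk.
  under eq_bigr do rewrite expr0.
  (* For k = 0 the sum is the order of F times 1, which is 0 by Lagrange in the additive group. *)
  have := @expg_cardG _ [set: F]%G (1%R : F) (finset.in_setT _).
  by rewrite finset.cardsT sumr_const => H; exact: H.
have [b b0 bk] : exists2 b : F, b != 0 & b ^+ k.+1 != 1.
  apply: contrapT => H; move: lk; rewrite ltnNge => /negP; apply.
  have nz : 'X^(k.+1) - 1%:P != 0 :> {poly F}.
    by rewrite -size_poly_eq0 size_XnsubC.
  have := @max_poly_roots F ('X^(k.+1) - 1%:P) (enum (predC1 (0 : F))) nz.
  rewrite enum_uniq -cardE cardC1 size_XnsubC // => /(_ _ isT); apply.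
  apply/allP => b; rewrite mem_enum inE => b0; rewrite rootE hornerD hornerN
    hornerXn hornerC.
  rewrite subr_eq0; apply/negPn/negP => bk; apply: H; by exists b.
have hb : injective (fun a : F => b * a) by exact: mulfI.
set S := \sum_a _; have : S = b ^+ k.+1 * S.
  rewrite /S [LHS](reindex_inj hb) big_distrr /=.
  by apply: eq_bigr => a _; rewrite exprMn.
move/eqP; rewrite -subr_eq0 -{1}[S]mul1r -mulrBl mulf_eq0 subr_eq0 eq_sym.
by rewrite (negPf bk) => /eqP.
Qed.

(** In each monomial some exponent is below [#|F|.-1]; the sum of the monomial is a product of power
    sums, one of which vanishes by [sum_expf]. *)
Lemma sum_degree_le d f : degree_le d f -> (d < #|I| * #|F|.-1)%N ->
  \sum_(a : E) f a = 0.
Proof.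
move=> + dI; elim=> [c m md|f1 h _ IH1 _ IH2|f1 h fh _ IH].
- rewrite -big_distrr /= -(bigA_distr_bigA (fun i (x : F) => x ^+ m i)).
  have [i mi] : exists i, (m i < #|F|.-1)%N.
    apply/existsP; apply: contraLR dI; rewrite negb_exists -leqNgt => /forallP
      H.
    apply: leq_trans md; rewrite -sum_nat_const; apply: leq_sum => i _.
    by rewrite leqNgt; exact: H.
  by rewrite (bigD1 i) //= sum_expf // mul0r mulr0.
- by rewrite big_split /= IH1 IH2 addr0.
- by under eq_bigr do rewrite -fh.
Qed.

Lemma degree_le_prod (J : Type) (r : seq J) (d : J -> nat) (f : J -> E -> F) :
  (forall j, degree_le (d j) (f j)) ->
  degree_le (\sum_(j <- r) d j) (fun a => \prod_(j <- r) f j a).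
Proof.
move=> df; elim: r => [|j r IH].
  by rewrite big_nil; apply: DegreeExt (degree_le_cst 0 1) => a; rewrite
    big_nil.
by rewrite big_cons; apply: DegreeExt (degree_le_mul (df j) IH) => a; rewrite
  big_cons.
Qed.

(** [P] is the indicator function of the common zeros, and its degree forces its sum to be 0; were
    the origin the only zero, the sum would be 1. *)
Lemma chevalley_warning (J : finType) (d : J -> nat) (f : J -> E -> F) :
  (forall j, degree_le (d j) (f j)) -> (forall j, f j 0 = 0) ->
  (\sum_j d j < #|I|)%N ->
  exists2 a : E, a != 0 & forall j, f j a = 0.
Proof.
move=> df f0 dI; apply: contrapT => H.
have q1 : (0 < #|F|.-1)%N by rewrite -ltnS prednK ?card_finNzRing_gt1 // ltnW
  // card_finNzRing_gt1.
pose P a := \prod_j (1 - f j a ^+ #|F|.-1).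
have dP : degree_le (\sum_j d j * #|F|.-1) P.
  apply: degree_le_prod => j; apply: DegreeAdd; first exact: degree_le_cst.
  apply: DegreeExt (degree_le_mul (degree_le_cst 0 (-1)) (degree_le_exp #|F|.-1
    (df j))) => a.
  by rewrite mulN1r.
have := sum_degree_le dP; rewrite -big_distrl /= ltn_pmul2r // => /(_ dI).
rewrite (bigD1 (0 : E)) //= {1}/P big1 => [|j _]; last by rewrite f0 expr0n
  eqn0Ngt q1 subr0.
rewrite big1 => [|a a0]; first by move/eqP; rewrite addr0 oner_eq0.
have [j fj] : exists j, f j a != 0.
  apply: contrapT => Ha; apply: H; exists a => // j.
  by apply/eqP/negPn/negP => fj; apply: Ha; exists j.
rewrite /P (bigD1 j) //= (_ : _ ^+ _ = 1) ?subrr ?mul0r //.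
apply: (mulfI fj); rewrite -exprS prednK ?expf_card ?mulr1 //.
by rewrite ltnW // card_finNzRing_gt1.
Qed.

End ChevalleyWarning.

(** * Linear forms and base change *)

Section LinearForms.
Variables (F : fieldType) (V : lmodType F).

Definition subspace (M : V -> Prop) :=
  M 0 /\ forall k u w, M u -> M w -> M (k *: u + w).

Lemma subspaceD M u w : subspace M -> M u -> M w -> M (u + w).
Proof. by case=> _ H Mu Mw; rewrite -[u]scale1r; exact: H. Qed.

Lemma subspaceZ M k u : subspace M -> M u -> M (k *: u).
Proof. by case=> H0 H Mu; rewrite -[_ *: _]addr0; exact: H. Qed.

Lemma maximal_subspace (S : V -> Prop) v : subspace S -> ~ S v ->
  exists M, [/\ subspace M, forall u, S u -> M u, ~ M v &
    forall w, ~ M w -> exists k, M (v - k *: w)].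
Proof.
move=> hS nSv.
(* The guard lets the empty union satisfy [P], as the empty chain requires. *)
pose P (M : set V) := (exists u, M u) ->
  [/\ subspace M, forall u, S u -> M u & ~ M v].
have [|M [PM Mmax]] := @Zorn_bigcup V P.
  move=> C CP totC [u0 [M0 CM0 M0u0]].
  have P0 M u : C M -> M u -> [/\ subspace M, forall u, S u -> M u & ~ M v].
    by move=> CM Mu; apply: (CP _ CM); exists u.
  split; first split.
  - by exists M0 => //; case: (P0 _ _ CM0 M0u0) => -[].
  - move=> k u w [Mu CMu Muu] [Mw CMw Mww].
    have [le|le] := totC _ _ CMu CMw.
      by exists Mw => //; case: (P0 _ _ CMw Mww) => -[_ H] _ _; apply: H => //;
        exact: le.
    by exists Mu => //; case: (P0 _ _ CMu Muu) => -[_ H] _ _; apply: H => //;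
      exact: le.
  - by move=> u Su; exists M0 => //; case: (P0 _ _ CM0 M0u0) => _ H _; exact: H.
  - by case=> Mv CMv Mvv; case: (P0 _ _ CMv Mvv).
have [u Mu] : exists u, M u.
  apply: contrapT => M0; apply: (Mmax S).
    split; first by move=> u Mu; case: M0; exists u.
    by move=> H; apply: M0; exists 0; apply: H; case: hS.
  by split.
have [hM SM nMv] := PM (ex_intro _ u Mu).
exists M; split=> // w nMw; apply: contrapT => H.
(* If no v - k w lies in M, then M + F w is a strictly larger subspace avoiding v. *)
pose M' : set V := fun a => exists m b, M m /\ a = m + b *: w.
apply: (Mmax M').
  split; first by move=> a Ma; exists a, 0; rewrite scale0r addr0.
  move=> sM; apply: nMw; apply: sM; exists 0, 1; rewrite scale1r add0r; split=>
    //.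
  by case: hM.
move=> _; split; first split.
- by exists 0, 0; rewrite scale0r addr0; split=> //; case: hM.
- move=> k _ _ [m1 [b1 [Mm1 ->]]] [m2 [b2 [Mm2 ->]]].
  exists (k *: m1 + m2), (k * b1 + b2); split; first by case: hM => _; apply.
  by rewrite scalerDr scalerDl scalerA addrACA.
- by move=> a Sa; exists a, 0; rewrite scale0r addr0; split=> //; exact: SM.
- case=> m [b [Mm vE]]; apply: H; exists b; by rewrite vE addrK.
Qed.

(** The maximal subspace M is a hyperplane complementary to the line of v, and f is the coordinate
    along v modulo M. *)
Lemma linear_form_separation (S : V -> Prop) v : subspace S -> ~ S v ->
  exists f : {linear V -> F^o}, (forall u, S u -> f u = 0) /\ f v = 1.
Proof.
move=> hS nSv; have [M [hM SM nMv Mmax]] := maximal_subspace hS nSv.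
have ex w : exists k, M (w - k *: v).
  have [Mw|nMw] := pselect (M w); first by exists 0; rewrite scale0r subr0.
  have [k Mk] := Mmax w nMw; have [k0|k0] := eqVneq k 0.
    by move: Mk; rewrite k0 scale0r subr0.
  exists k^-1; have -> : w - k^-1 *: v = (- k^-1) *: (v - k *: w).
    by rewrite scalerBr !scalerA mulNr mulVf // !scaleNr scale1r opprK addrC.
  exact: subspaceZ.
have uniq w k l : M (w - k *: v) -> M (w - l *: v) -> k = l.
  move=> Mk Ml; apply: contrapT => /eqP kl; apply: nMv.
  have : M ((w - l *: v) - (w - k *: v)).
    by apply: subspaceD => //; rewrite -scaleN1r; exact: subspaceZ.
  rewrite opprB addrC addrA subrK -scalerBl => /(subspaceZ (k - l)^-1 hM).
  by rewrite scalerA mulVf ?scale1r // subr_eq0.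
pose f w : F^o := projT1 (cid (ex w)).
have fP w : M (w - f w *: v) := projT2 (cid (ex w)).
have f_linear : linear f.
  move=> k u w; apply: (uniq (k *: u + w)) => //.
  have -> : k *: u + w - (k *: f u + f w) *: v = k *: (u - f u *: v) + (w - f w
    *: v).
    by rewrite scalerDl scalerBr scalerA opprD addrACA.
  by case: hM => _; apply.
pose f' : {linear V -> F^o} := HB.pack f (GRing.isLinear.Build _ _ _ _ f
  f_linear).
exists f'; split=> [u Su|] /=.
  by apply: (uniq u) => //; rewrite scale0r subr0; exact: SM.
by apply: (uniq v) => //; rewrite scale1r subrr; case: hM.
Qed.

End LinearForms.

Section BaseChangeBasis.
Variables (F K : fieldType) (iota : {rmorphism F -> K}).
Variables (V : lmodType F) (W : vectType K) (J : {linear V -> W | iota \;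
  *:%R}).

(* The two consequences of the universal property of W = V (x)_F K. *)
Hypothesis J_ext : forall h1 h2 : {linear W -> W}, h1 \o J =1 h2 \o J -> h1 =1
  h2.
Hypothesis J_form : forall f : {linear V -> F^o},
  exists h : {linear W -> K^o}, forall v, h (J v) = iota (f v).

(** If the span of the current family contained the image of J, the projection onto it would agree
    with the identity there, hence everywhere by [J_ext]. *)
Lemma base_change_free k : (k <= \dim {:W})%N ->
  exists s : seq V, size s = k /\ free (map J s).
Proof.
elim: k => [|k IH] lk; first by exists [::]; split=> //; exact: nil_free.
have [s [ss fs]] := IH (ltnW lk).
have [a na] : exists a, J a \notin <<map J s>>%VS.
  apply: contrapT => H.
  have idE : projv <<map J s>> =1 (idfun : {linear W -> W}).
    apply: (J_ext (h1 := projv <<map J s>>)) => a; rewrite /= projv_id //.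
    by apply/negPn/negP => na; apply: H; exists a.
  have : ({:W} <= <<map J s>>)%VS.
    by apply/subvP => w _; rewrite -[w]idE memv_proj.
  move/dimvS; rewrite leqNgt; apply/negP; rewrite negbK.
  by apply: leq_ltn_trans (dim_span _) _; rewrite size_map ss.
by exists (a :: s); rewrite /= ss free_cons na.
Qed.

(** For spanning over F: a form vanishing on all e_i but equal to 1 at v would extend to a form on W
    that kills the basis J(e_i), yet is 1 at J(v). *)
Lemma base_change_basis (I : finType) : \dim {:W} = #|I| ->
  exists e : I -> V, [/\ forall v, exists c : I -> F, v = \sum_i c i *: e i,
    forall w, exists c : I -> K, w = \sum_i c i *: J (e i) &
    forall c : I -> K, \sum_i c i *: J (e i) = 0 -> forall i, c i = 0].
Proof.
move=> dimW; have [s [ss fs]] := base_change_free (leqnn _).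
rewrite dimW in ss.
have sT : <<map J s>>%VS = fullv.
  apply/eqP; rewrite eqEdim subvf /= dimW.
  by move: fs; rewrite /free size_map ss => /eqP ->.
pose e (i : I) := nth 0 s (enum_rank i).
pose X : #|I|.-tuple W := Tuple (introT eqP (etrans (size_map J s) ss)).
have Xe i : X`_(enum_rank i) = J (e i) by rewrite /= (nth_map 0) // ss.
have sumE (c : 'I_#|I| -> K) : \sum_(i < #|I|) c i *: X`_i = \sum_i c
  (enum_rank i) *: J (e i).
  rewrite (reindex enum_rank) /=; last by apply: onW_bij; exact: enum_rank_bij.
  by apply: eq_bigr => i _; rewrite Xe.
have spanK w : exists c : I -> K, w = \sum_i c i *: J (e i).
  exists (fun i => coord X (enum_rank i) w); rewrite -(sumE (fun i => coord X i
    w)).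
  by apply: coord_span; rewrite /= sT memvf.
exists e; split=> //.
- move=> v; pose S u := exists c : I -> F, u = \sum_i c i *: e i.
  apply: contrapT => nSv; have hS : subspace S.
    split; first by exists (fun=> 0); rewrite big1 // => i _; rewrite scale0r.
    move=> k _ _ [c ->] [d ->]; exists (fun i => k * c i + d i).
    rewrite scaler_sumr -big_split; apply: eq_bigr => i _ /=.
    by rewrite scalerDl scalerA.
  have [f [fS fv]] := linear_form_separation hS nSv; have [h hE] := J_form f.
  have fe i : f (e i) = 0.
    apply: fS; exists (fun k => (k == i)%:R); rewrite (bigD1 i) //= eqxx
      scale1r.
    by rewrite big1 ?addr0 // => k /negPf ->; rewrite scale0r.
  have [c cE] := spanK (J v); have := hE v; rewrite cE linear_sum big1 => [|i
    _].
    by rewrite fv rmorph1 => /esym/eqP; rewrite oner_eq0.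
  by rewrite linearZ /= hE fe rmorph0; apply: mulr0.
- move=> c c0 i; have /freeP H : free X by [].
  have := H (fun i => c (enum_val i)); rewrite sumE.
  under eq_bigr do rewrite enum_rankK.
  by move=> /(_ c0 (enum_rank i)); rewrite enum_rankK.
Qed.

End BaseChangeBasis.

Section QuadAlgIso.
Variable F : fieldType.

Lemma quadAlg_iso_sym (A B : quadAlg F) : quadAlg_iso A B -> quadAlg_iso B A.
Proof.
case=> f [[g fK gK] fM fN].
have g_linear : linear g := can2_linear fK gK.
pose g' : {linear B -> A} := HB.pack g (GRing.isLinear.Build _ _ _ _ g
  g_linear).
exists g'; split=> [|u v|u] /=; first by exists f.
- by apply: (can_inj fK); rewrite fM !gK.
- by rewrite -fN gK.
Qed.

End QuadAlgIso.

Section OkuboEmbedding.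
Variables (F : fieldType) (A : quadAlg F).

(** J is the base change map followed by the isomorphism with the split algebra. Uniqueness in the
    universal property gives [J_ext], existence gives [J_form]. *)
Lemma is_okubo_embedding : is_okubo A ->
  exists (K : fieldType) (iota : {rmorphism F -> K})
    (J : {linear A -> split_okubo K | iota \; *:%R}) (e : oindex -> A),
  [/\ {morph J : a b / qmul A a b >-> qmul (split_okubo K) a b},
      forall a, qnorm (split_okubo K) (J a) = iota (qnorm A a),
      forall a, exists c : oindex -> F, a = \sum_i c i *: e i,
      forall w, exists c : oindex -> K, w = \sum_i c i *: J (e i) &
      forall c : oindex -> K, \sum_i c i *: J (e i) = 0 -> forall i, c i = 0].
Proof.
case=> K [iota [B [_ [j [jU jM jN]] [h [[g hK gK] hM hN]]]]].
have g_linear : linear g := can2_linear hK gK.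
pose g' : {linear split_okubo K -> B} :=
  HB.pack g (GRing.isLinear.Build _ _ _ _ g g_linear).
have J_linear : linear_for (iota \; *:%R) (fun a => h (j a)).
  by move=> k u v; rewrite linearP /= linearP.
pose J : {linear A -> split_okubo K | iota \; *:%R} :=
  HB.pack (fun a => h (j a)) (GRing.isLinear.Build _ _ _ _ _ J_linear).
have J_ext (h1 h2 : {linear split_okubo K -> split_okubo K}) :
    h1 \o J =1 h2 \o J -> h1 =1 h2.
  move=> h12 w.
  have L_linear : linear_for (iota \; *:%R) (fun a => h1 (J a)).
    by move=> k u v; rewrite linearP /= linearP.
  pose L : {linear A -> split_okubo K | iota \; *:%R} :=
    HB.pack (fun a => h1 (J a)) (GRing.isLinear.Build _ _ _ _ _ L_linear).
  have [h0 [_ h0U]] := jU _ L.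
  rewrite -(gK w) -[LHS]/((h1 \o h) (g w)) -[RHS]/((h2 \o h) (g w)).
  by rewrite (h0U (h1 \o h)) ?(h0U (h2 \o h)) // => a; rewrite /= -[LHS](h12 a).
have J_form (f : {linear A -> F^o}) :
    exists k : {linear split_okubo K -> K^o}, forall a, k (J a) = iota (f a).
  have L_linear : linear_for (iota \; *:%R) (fun a => iota (f a) : K^o).
    by move=> k u v; rewrite linearP /= rmorphD rmorphM.
  pose L : {linear A -> K^o | iota \; *:%R} :=
    HB.pack (fun a => iota (f a) : K^o) (GRing.isLinear.Build _ _ _ _ _
      L_linear).
  have [h0 [h0E _]] := jU _ L.
  by exists (h0 \o g') => a; rewrite /= hK -[LHS]/((h0 \o j) a) h0E.
have dimW : \dim {: {ffun oindex -> K^o}} = #|{: oindex}|.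
  by rewrite dimvf /dim /= muln1.
have [e [spanF spanK freeK]] :=
  @base_change_basis F K iota A {ffun oindex -> K^o} J J_ext J_form _ dimW.
exists K, iota, J, e; split=> // [a b|a] /=.
- by rewrite jM hM.
- exact: etrans (hN _) (jN a).
Qed.

End OkuboEmbedding.

(** * Okubo algebras over a finite field *)

Section OkuboTransfer.
Variables (F K : fieldType) (iota : {rmorphism F -> K}) (A : quadAlg F).
Local Notation S := (split_okubo K).
Variables (J : {linear A -> S | iota \; *:%R}) (e : oindex -> A).
Hypothesis JM : {morph J : a b / qmul A a b >-> qmul S a b}.
Hypothesis JN : forall a, qnorm S (J a) = iota (qnorm A a).
Hypothesis spanF : forall a, exists c : oindex -> F, a = \sum_i c i *: e i.
Hypothesis spanK : forall w, exists c : oindex -> K, w = \sum_i c i *: J (e i).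
Hypothesis freeK : forall c : oindex -> K,
  \sum_i c i *: J (e i) = 0 -> forall i, c i = 0.

Let JZ k a : J (k *: a) = iota k *: J a. Proof. exact: linearZ_LR. Qed.

Let JP a b : '[J a, J b] = iota '[a, b].
Proof. by rewrite /qpolar /polar -raddfD !JN !rmorphB. Qed.

Lemma embedding_free (c : oindex -> F) :
  \sum_i c i *: e i = 0 -> forall i, c i = 0.
Proof.
move=> c0 i; apply: (fmorph_inj iota); rewrite rmorph0.
apply: (freeK (c := fun i => iota (c i))).
transitivity (J (\sum_i c i *: e i)); last by rewrite c0 raddf0.
by rewrite raddf_sum; apply: eq_bigr => k _; exact: esym (JZ _ _).
Qed.

Let J_inj : injective J.
Proof.
apply: raddf_inj => a Ja; have [c aE] := spanF a.
rewrite aE big1 // => i _; suff -> : c i = 0 by rewrite scale0r.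
apply: (fmorph_inj iota); rewrite rmorph0.
apply: (freeK (c := fun i => iota (c i))); rewrite -[RHS]Ja aE raddf_sum.
by apply: eq_bigr => k _; exact: esym (JZ _ _).
Qed.

Lemma embedding_symmetric : symmetric_composition A.
Proof.
have [H1 H2 H3] := split_symmetric K.
split=> [a b|a b|a b c].
- by apply: J_inj; rewrite !JM H1 JZ JN.
- by apply: J_inj; rewrite !JM H2 JZ JN.
- by apply: (fmorph_inj iota); rewrite -!JP !JM H3.
Qed.

(** The image of an element orthogonal to [A] is orthogonal to all J(e_i), which span the split
    algebra; centrality is transferred likewise. *)
Lemma embedding_nondegenerate : polar_nondegenerate A.
Proof.
move=> a Ha; apply: J_inj; rewrite raddf0; apply: split_nondegenerate => w.
have [c ->] := spanK w; rewrite linear_sumr big1 // => i _ /=.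
by rewrite qpolarZr JP Ha rmorph0 mulr0.
Qed.

Lemma embedding_centerless : centerless A.
Proof.
move=> a Ha; apply: J_inj; rewrite raddf0; apply: split_centerless => w.
have [c ->] := spanK w; rewrite linear_sumr linear_sumlz; apply: eq_bigr => i _.
by rewrite smulZr smulZl -!JM Ha.
Qed.

End OkuboTransfer.

Section FormsOverFiniteField.
Variables (F : finFieldType) (A : quadAlg F) (I : finType) (e : I -> A).
Hypothesis free_e : forall c : I -> F, \sum_i c i *: e i = 0 -> forall i, c i =
  0.

Let comb (c : {ffun I -> F}) : A := \sum_i c i *: e i.

Let comb_neq0 c : c != 0 -> comb c != 0.
Proof.
apply: contraNneq => c0; apply/eqP/ffunP => i; rewrite ffunE.
exact: (free_e (c := c)).
Qed.

Let comb0 : comb 0 = 0.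
Proof. by rewrite /comb big1 // => i _; rewrite ffunE scale0r. Qed.

Lemma degree_le_polar a : degree_le 1 (fun c => '[comb c, a]).
Proof.
apply: (@DegreeExt _ _ _ (fun c => \sum_i c i * '[e i, a])).
  by move=> c; rewrite linear_sumlz; apply: eq_bigr => i _; rewrite /= qpolarZl.
apply: degree_le_sum => i; rewrite -[1%N]addn0.
by apply: degree_le_mul; [exact: degree_le_var | exact: degree_le_cst].
Qed.

(** Induction on the family, with n(c e + s) = c^2 n(e) + n(s) + c n(e, s). *)
Lemma degree_le_qnorm : degree_le 2 (fun c => qnorm A (comb c)).
Proof.
rewrite /comb; elim: (index_enum I) => [|i r IH].
  by apply: DegreeExt (degree_le_cst I 2 (0 : F)) => c; rewrite big_nil qnorm0.
have dr : degree_le 1 (fun c : {ffun I -> F} => \sum_(j <- r) c j * '[e i, e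
  j]).
  apply: degree_le_sum => j; rewrite -[1%N]addn0.
  by apply: degree_le_mul; [exact: degree_le_var | exact: degree_le_cst].
have d1 := degree_le_mul (degree_le_var F i) dr.
have d2 := degree_le_mul (degree_le_exp 2 (degree_le_var F i)) (degree_le_cst I
  0 (qnorm A (e i))).
apply: DegreeExt (DegreeAdd (DegreeAdd d2 IH) d1) => c.
rewrite big_cons qnormD qnormZ qpolarZl linear_sumr /=; congr (_ + _ * _).
by apply: eq_bigr => j _; rewrite qpolarZr.
Qed.

Lemma degree_le_cubic : degree_le 3 (fun c => cubic (comb c)).
Proof.
apply: (@DegreeExt _ _ _ (fun c => \sum_i \sum_j c i * (c j * '[comb c, e i **
  e j]))).
  move=> c.
  rewrite -[RHS]/('[comb c, (\sum_i c i *: e i) ** (\sum_j c j *: e j)]).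
  rewrite (linear_sumlz (qmul A)) linear_sumr; apply: eq_bigr => i _.
  rewrite /= (linear_sumr (qmul A)) linear_sumr; apply: eq_bigr => j _ /=.
  by rewrite smulZl smulZr !qpolarZr.
apply: degree_le_sum => i; apply: degree_le_sum => j; rewrite -[3%N]/(1 + (1 +
  1))%N.
apply: degree_le_mul; first exact: degree_le_var.
by apply: degree_le_mul; [exact: degree_le_var | exact: degree_le_polar].
Qed.

Lemma isotropic_orthogonal a b : (4 < #|I|)%N ->
  exists h : A, [/\ h != 0, qnorm A h = 0, '[h, a] = 0 & '[h, b] = 0].
Proof.
move=> cardI.
(* One quadratic and two linear equations, of total degree 4. *)
pose d (j : 'I_3) := nth 0%N [:: 2; 1; 1]%N j.
pose f (j : 'I_3) := nth (fun=> 0) [:: fun c => qnorm A (comb c);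
  fun c => '[comb c, a]; fun c => '[comb c, b]] j.
have [|||c c0 H] := @chevalley_warning F I _ d f.
- case=> [[|[|[|//]]] ?] /=; [exact: degree_le_qnorm | |];
    exact: degree_le_polar.
- by case=> [[|[|[|//]]] ?]; rewrite /f /= comb0 ?qnorm0 ?qpolar0l.
- by rewrite !big_ord_recl big_ord0.
exists (comb c); split; first exact: comb_neq0.
- exact: H (@Ordinal 3 0 isT).
- exact: H (@Ordinal 3 1 isT).
- exact: H (@Ordinal 3 2 isT).
Qed.

Lemma isotropic_cubic0 : (5 < #|I|)%N ->
  exists u : A, [/\ u != 0, qnorm A u = 0 & cubic u = 0].
Proof.
move=> cardI.
(* The norm and the cubic form have total degree 5. *)
pose d (j : 'I_2) := nth 0%N [:: 2; 3]%N j.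
pose f (j : 'I_2) := nth (fun=> 0) [:: fun c => qnorm A (comb c);
  fun c => cubic (comb c)] j.
have [|||c c0 H] := @chevalley_warning F I _ d f.
- by case=> [[|[|//]] ?] /=; [exact: degree_le_qnorm | exact: degree_le_cubic].
- by case=> [[|[|//]] ?]; rewrite /f /= comb0 ?qnorm0 // /cubic qpolar0l.
- by rewrite !big_ord_recl big_ord0.
exists (comb c); split; first exact: comb_neq0.
- exact: H (@Ordinal 2 0 isT).
- exact: H (@Ordinal 2 1 isT).
Qed.

End FormsOverFiniteField.

Section NormalizedPair.
Variables (F : finFieldType) (A : quadAlg F).
Hypothesis symA : symmetric_composition A.
Hypothesis ndA : polar_nondegenerate A.
Hypothesis centA : centerless A.

Lemma normalized_of_isotropic (u : A) : u != 0 -> qnorm A u = 0 -> cubic u = 0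
  ->
  exists x : A, normalized x.
Proof.
move=> u0 nu gu.
have [v [v0 nv vv]] : exists v : A, [/\ v != 0, qnorm A v = 0 & v ** v = 0].
  have [uu|uu] := eqVneq (u ** u) 0; first by exists u.
  exists (u ** u); split=> //; first by rewrite (qnormM symA) nu mulr0.
  by rewrite (smul_sqr symA) nu gu !scale0r subr0.
have [a va] : exists a, '[v, a] != 0.
  apply: contrapT => H; case/eqP: v0; apply: ndA => a.
  by apply/eqP/negPn/negP => va; apply: H; exists a.
(* The second factor is scaled to pair to -1 with v, so that [cubic_mul_sqr0] gives the value 1. *)
exists (v ** (- '[v, a]^-1 *: a)); split.
  by rewrite (qnormM symA) nv mul0r.
rewrite (cubic_mul_sqr0 symA) // qpolarZr mulNr mulVf //; ring.
Qed.

(** In characteristic 3, cubing is injective on a finite field, hence onto, and scaling v suffices.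
    Otherwise the form of [cubic_frame] at (1 + t, -t, t) equals g(v) (1 + 3 t), which takes every
    value. *)
Lemma normalize_cubic (x v : A) : normalized x -> peirce x v -> cubic v != 0 ->
  exists2 y, peirce x y & cubic y = 1.
Proof.
move=> hx hv gv; have [ch3|ch3] := eqVneq (3%:R : F) 0.
  have [s sE] : exists s : F, s ^+ 3 = (cubic v)^-1.
    have [t _ tK] := injF_bij (cube_inj_char3 ch3).
    by exists (t (cubic v)^-1); exact: tK.
  exists (s *: v); first exact: peirceZ.
  by rewrite cubicZ sE mulVf.
pose t : F := ((cubic v)^-1 - 1) / 3%:R.
exists ((1 + t) *: v + (- t) *: (x ** v) + t *: (x ** (x ** v))).
  have hxv := peirce_xmul symA hx hv.
  by do !apply: peirceD; apply: peirceZ => //; exact: peirce_xmul.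
rewrite (cubic_frame symA hx hv).
have -> : (1 + t) ^+ 3 - (- t) ^+ 3 + t ^+ 3 + 3%:R * ((1 + t) * - t * t) = 1 +
  3%:R * t.
  by ring.
by rewrite /t; field; rewrite gv ch3.
Qed.

Lemma normalized_pair (x0 : A) : normalized x0 ->
  (forall a b : A, exists h : A, [/\ h != 0, qnorm A h = 0, '[h, a] = 0 & '[h,
    b] = 0]) ->
  exists2 x : A, normalized x & exists2 y, peirce x y & cubic y = 1.
Proof.
move=> hx0 isoA.
suff [x hx [v hv gv]] : exists2 x : A, normalized x & exists2 v, peirce x v &
  cubic v != 0.
  by exists x => //; exact: normalize_cubic hv gv.
have [ch3|ch3] := eqVneq (3%:R : F) 0.
  by apply: cubic_neq0_char3 => //; exists x0.
by exists x0 => //; exact: cubic_neq0_not3.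
Qed.

End NormalizedPair.

Lemma card_oindex : #|{: oindex}| = 8%N.
Proof. by rewrite card_sig cardC1 card_prod !card_ord. Qed.

Theorem theorem3p2 (F : finFieldType) (O : quadAlg F) :
  is_okubo O -> quadAlg_iso O (split_okubo F).
Proof.
move=> /is_okubo_embedding[K [iota [J [e [JM JN spanF spanK freeK]]]]].
have symO := embedding_symmetric JM JN spanF freeK.
have ndO := embedding_nondegenerate JN spanF spanK freeK.
have centO := embedding_centerless JM spanF spanK freeK.
have free_e := embedding_free freeK.
have [|u [u0 nu gu]] := isotropic_cubic0 free_e; first by rewrite card_oindex.
have [x0 hx0] := normalized_of_isotropic symO ndO u0 nu gu.
have [|x hx [y hy gy]] := normalized_pair symO ndO centO hx0.
  by move=> a b; apply: (isotropic_orthogonal free_e); rewrite card_oindex.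
apply: quadAlg_iso_sym; exists (frame_map x y); split.
- have f_inj := frame_map_inj symO hx hy gy.
  have comb_surj (a : O) : exists c : {ffun oindex -> F^o}, a = \sum_i c i *: e
    i.
    have [c ->] := spanF a; exists [ffun i => c i].
    by apply: eq_bigr => i _; rewrite ffunE.
  (* Surjectivity by counting: [psi] lists coordinates of the image with respect to the family [e],
     and an injective self-map of the finite set of coordinate vectors is onto. *)
  pose psi u := projT1 (cid (comb_surj (frame_map x y u))).
  have psiK u : frame_map x y u = \sum_i psi u i *: e i := projT2 (cid
    (comb_surj _)).
  have [phi _ phiK] : bijective psi.
    by apply: injF_bij => c d cd; apply: f_inj; rewrite !psiK cd.
  have surj a : exists u, frame_map x y u = a.
    by have [c ->] := comb_surj a; exists (phi c); rewrite psiK phiK.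
  exists (fun a => projT1 (cid (surj a))) => [c|a]; last exact: projT2 (cid
    (surj a)).
  by apply: f_inj; exact: projT2 (cid (surj _)).
- exact: frame_mapM.
- exact: frame_map_norm.
Qed.
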